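(* Let $A,B\in\mathbb{R}^{2\times2}$ with $\det(B)\neq0$. The delay-differential equation $\dot x(t)=Ax(t)+Bx(t-\tau)$ is of universality class I if and only if the equation $$\left[\frac{K_+^2(\omega)+H_+^2(\omega)}{4(\det(B))^2}-1\right]\left[\frac{K_-^2(\omega)+H_-^2(\omega)}{4(\det(B))^2}-1\right]=0$$ possesses only one pair of simple (real) roots $\omega=\omega_H$ and $\omega=-\omega_H$. In this case, the system has a sequence of destabilizing delay-induced crossings of the critical characteristic roots with $\lambda_c=\pm i\omega_H$ for the time delays $\tau_k=\frac1{\omega_H}(\phi_H+2\pi k)$, $k=0,1,2,\dots$, and there are no other transverse delay-induced crossings of the characteristic roots, where $$\phi_H=\arg\left[\frac{K_+(\omega_H)-iH_+(\omega_H)}{2\det(B)}\right]$$ if the simple root $\omega_H$ is a root of the first factor in the equation above, and $$\phi_H=\arg\left[\frac{K_-(\omega_H)-iH_-(\omega_H)}{2\det(B)}\right]$$ otherwise.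
   Context: Notation: $C=\det(A+B)-\det(A)-\det(B)$, $z(\omega)=\mu\omega^2+\eta+i\omega\kappa$ with $\mu=4\det(B)-(\operatorname{Tr}(B))^2$, $\eta=C^2-4\det(A)\det(B)$, $\kappa=4\operatorname{Tr}(A)\det(B)-2\operatorname{Tr}(B)C$; and $$K_\pm(\omega)=-C\pm\operatorname{Re}\sqrt{z(\omega)},\qquad H_\pm(\omega)=\omega\operatorname{Tr}(B)\pm\operatorname{Im}\sqrt{z(\omega)},$$ with $\sqrt{\cdot}$ the principal square root. $\arg$ is the principal argument in $(-\pi,\pi]$. The characteristic equation is $\det[\lambda I-A-Be^{-\lambda\tau}]=0$, with delay $\tau>0$ regarded as a parameter; its solutions are the characteristic roots. Delay-induced transverse crossing at $\tau=\tau_H$: there is a family of roots $\lambda(\tau)=\alpha(\tau)\pm i\mu(\tau)$ of the characteristic equation with $\alpha(\tau_H)=0$ and $\frac{d\alpha}{d\tau}(\tau_H)\neq0$; it is destabilizing if $\frac{d\alpha}{d\tau}(\tau_H)>0$ and stabilizing if $\frac{d\alpha}{d\tau}(\tau_H)<0$. Generating polynomial: $p_\omega(Y)=\det[i\omega I-A-BY]$. Asymptotic continuous spectrum (ACS): the collection of curves $\left\{\frac1\tau\gamma_j(\omega)+i\omega\right\}$, $\omega\in\mathbb{R}$, $j=1,\dots,m$, where $\gamma_j(\omega)=-\ln|Y_j(\omega)|$ and $Y_j(\omega)$ are the roots of the generating polynomial, $p_\omega(Y_j(\omega))=0$. Points $\omega$ for which the polynomial is degenerate, i.e. $p_\omega(Y)\equiv\det[i\omega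 I-A]$ for all $Y$, are excluded. Here there are two branches, given by $Y_{1,2}(\omega)=\frac{1}{2\det(B)}[K_\pm(\omega)+iH_\pm(\omega)]$. Universality class I: the ACS (and the DDE) is of universality class I if there exist $\omega_H>0$ and $j\in\mathbb{N}$ such that one branch of the ACS satisfies $\gamma_j(\pm\omega_H)=0$, $\gamma_j(\omega)>0$ for all $\omega\in(-\omega_H,\omega_H)$, and $\gamma_j(\omega)<0$ for all $\omega\notin[-\omega_H,\omega_H]$; also $\gamma_k(\omega)\neq0$ for all $k\neq j$ and $\omega\in\mathbb{R}$.
   Formalization: The equivalence is stated for class I together with transversality (each branch γ has nonzero derivative wherever it vanishes); class I alone allows a triple root at ω_H, so the literal ''only if'' fails. The ''if'' direction and the crossing claims need no extra hypothesis. *)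

(* Defs.v *)
From HB Require Import structures.
From mathcomp Require Import all_boot all_order all_algebra.
From mathcomp.real_closed Require Import complex.
From mathcomp Require Import all_classical all_reals all_analysis.
From mathcomp Require Import ring.

Set Implicit Arguments.
Unset Strict Implicit.
Unset Printing Implicit Defensive.

Import Order.TTheory GRing.Theory Num.Theory.
Import numFieldNormedType.Exports.
Local Open Scope classical_set_scope.
Local Open Scope ring_scope.
Local Open Scope complex_scope.

Lemma det_mx2 (F : comPzRingType) (M : 'M[F]_2) :
  \det M = M 0 0 * M 1 1 - M 0 1 * M 1 0.
Proof.
rewrite (expand_det_row _ 0) !big_ord_recl big_ord0 addr0 /cofactor !det_mx11.
rewrite !mxE /= expr0 expr1 mul1r mulN1r mulrN.
by congr (M _ _ * M _ _ - M _ _ * M _ _); apply: val_inj.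
Qed.

Section ComplexFunctions.
Variable R : realType.

Definition cexp (u : R[i]) : R[i] :=
  (expR (complex.Re u) * cos (complex.Im u)) +i*
  (expR (complex.Re u) * sin (complex.Im u)).

(* Principal argument, with values in ]-pi, pi]. *)
Definition carg (u : R[i]) : R :=
  let t := acos (complex.Re u / ComplexField.Normc.normc u) in
  if 0 <= complex.Im u then t else - t.

Definition simple_root (f : R -> R) (x : R) : Prop :=
  f x = 0 /\ exists2 d : R, is_derive x 1 f d & d != 0.

Definition only_simple_pair (f : R -> R) (wH : R) : Prop :=
  [/\ 0 < wH, simple_root f wH, simple_root f (- wH)
    & forall w : R, f w = 0 -> w = wH \/ w = - wH].

End ComplexFunctions.

Section DDE.
Variable R : realType.
Variables A B : 'M[R]_2.

Definition chardet (lam Y : R[i]) : R[i] :=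
  \det (lam%:M - map_mx (real_complex R) A
               - Y *: map_mx (real_complex R) B).

Definition genpoly (w : R) (Y : R[i]) : R[i] := chardet (0 +i* w) Y.

Definition char_root (tau : R) (lam : R[i]) : Prop :=
  chardet lam (cexp (- (tau%:C * lam))) = 0.

Definition coefC : R := \det (A + B) - \det A - \det B.
Definition coef_mu : R := 4 * \det B - \tr B ^+ 2.
Definition coef_eta : R := coefC ^+ 2 - 4 * \det A * \det B.
Definition coef_kappa : R := 4 * \tr A * \det B - 2 * \tr B * coefC.

Definition zdisc (w : R) : R[i] :=
  (coef_mu * w ^+ 2 + coef_eta) +i* (w * coef_kappa).

(* The two branches are indexed by bool: false is the sign +, true the
   sign -.  [sqrtc] is the principal complex square root (unlike the
   algebraically closed field operation [sqrtC]). *)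
Definition Kbr (s : bool) (w : R) : R :=
  - coefC + (-1) ^+ s * complex.Re (sqrtc (zdisc w)).
Definition Hbr (s : bool) (w : R) : R :=
  w * \tr B + (-1) ^+ s * complex.Im (sqrtc (zdisc w)).

Definition Ybr (s : bool) (w : R) : R[i] :=
  (Kbr s w +i* Hbr s w) / (2 * \det B)%:C.

(* Y_+(w) and Y_-(w) are exactly the roots of the generating polynomial. *)
Lemma genpolyE (w : R) (Y : R[i]) : \det B != 0 ->
  genpoly w Y = (\det B)%:C * (Y - Ybr false w) * (Y - Ybr true w).
Proof.
move=> dB0; pose d := (\det B)%:C; pose r := sqrtc (zdisc w).
have d0 : d != 0 by rewrite /d fmorph_eq0.
have rE : r ^+ 2 = zdisc w by exact: sqr_sqrtc.
pose c := (coefC)%:C; pose iw : R[i] := 0 +i* w; pose b := (\tr B)%:C.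
have YE s : Ybr s w = (- c + iw * b + (-1) ^+ s * r) / (2 * d).
  rewrite /Ybr rmorphM rmorph_nat; congr (_ / _).
  rewrite /c /iw /b /Kbr /Hbr -/r; case: r {rE} => x y; case: s; simpc => /=;
  by apply/eqP; rewrite eq_complex /=; apply/andP; split; apply/eqP; ring.
have zE : zdisc w = (c - iw * b) ^+ 2
    - 4 * d * (iw ^+ 2 - iw * (\tr A)%:C + (\det A)%:C).
  rewrite /zdisc /coef_mu /coef_eta /coef_kappa /c /iw /b /d -[4]/(4%:R).
  rewrite !expr2 -!(rmorph_nat (real_complex R)); simpc.
  by apply/eqP; rewrite eq_complex /=; apply/andP; split; apply/eqP; ring.
have pE : genpoly w Y = d * Y ^+ 2 + (c - iw * b) * Y
    + (iw ^+ 2 - iw * (\tr A)%:C + (\det A)%:C).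
  rewrite /genpoly /chardet -/iw /d /c /b /coefC /mxtrace.
  rewrite !big_ord_recl !big_ord0 !addr0 !det_mx2 !mxE /=.
  have -> : lift ord0 ord0 = 1 :> 'I_2 by apply: val_inj.
  have -> : ord0 = 0 :> 'I_2 by [].
  rewrite /= !mulr1n !mulr0n.
  rewrite !(rmorphD, rmorphB, rmorphM, rmorphN) /=.
  by ring.
rewrite pE -/d !YE expr0 expr1 mul1r mulN1r.
have -> : iw ^+ 2 - iw * (\tr A)%:C + (\det A)%:C =
    ((c - iw * b) ^+ 2 - r ^+ 2) / (4 * d) by rewrite rE zE; field.
by field.
Qed.

(* The branches of the asymptotic continuous spectrum.  The logarithm is
   extended-real valued, so that the branch is +oo where Y vanishes (the
   real-valued [ln] is 0 at 0). *)
Definition gamma (s : bool) (w : R) : \bar R :=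
  (- lne (ComplexField.Normc.normc (Ybr s w))%:E)%E.

Definition class_I : Prop :=
  exists2 wH : R, 0 < wH & exists j : bool,
    [/\ gamma j wH = 0%E, gamma j (- wH) = 0%E,
        forall w : R, - wH < w < wH -> (0 < gamma j w)%E,
        forall w : R, (w < - wH) || (wH < w) -> (gamma j w < 0)%E
      & forall (k : bool) (w : R), k != j -> gamma k w <> 0%E].

(* The branches meet the imaginary axis transversally.  This does not follow
   from [class_I]: its sign conditions allow gamma to vanish at wH together
   with its first two derivatives, and then wH is a multiple root of
   [modulus_eq] and no transverse crossing occurs. *)
Definition ACS_transversal : Prop :=
  forall (s : bool) (w : R), gamma s w = 0%E ->
    exists2 d : R, is_derive w 1 (fine \o gamma s) d & d != 0.

Definition modulus_factor (s : bool) (w : R) : R :=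
  (Kbr s w ^+ 2 + Hbr s w ^+ 2) / (4 * \det B ^+ 2) - 1.

Definition modulus_eq (w : R) : R :=
  modulus_factor false w * modulus_factor true w.

(* Near tau0 there is a continuous family of pairs of characteristic roots
   alpha(tau) +/- i beta(tau) which, at tau0, is at +/- i w on the imaginary
   axis, with d alpha / d tau (tau0) = v. *)
Definition crossing (tau0 w v : R) : Prop :=
  exists alpha beta : R -> R,
    [/\ \forall tau \near tau0,
          [/\ {for tau, continuous alpha}, {for tau, continuous beta},
              char_root tau (alpha tau +i* beta tau)
            & char_root tau (alpha tau -i* beta tau)],
        alpha tau0 = 0, beta tau0 = w & is_derive tau0 1 alpha v].

Definition transverse_crossing (tau0 w : R) : Prop :=
  exists2 v : R, v != 0 & crossing tau0 w v.

Definition destabilizing_crossing (tau0 w : R) : Prop :=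
  exists2 v : R, 0 < v & crossing tau0 w v.

Definition stabilizing_crossing (tau0 w : R) : Prop :=
  exists2 v : R, v < 0 & crossing tau0 w v.

Definition phiH (wH : R) : R :=
  let s := modulus_factor false wH != 0 in
  carg ((Kbr s wH -i* Hbr s wH) / (2 * \det B)%:C).

Definition tauk (wH : R) (k : nat) : R := wH^-1 * (phiH wH + 2 * pi * k%:R).

End DDE.

(* Main.v *)
(* Write Y_s for the two roots of the generating polynomial, F_s = |Y_s|^2 - 1,
   f = F_+ F_- and S = F_+ + F_-.  The principal square root makes the F_s
   discontinuous in general, but S is continuous and |Y_+ Y_-|^2 = 1 + S + f is
   a polynomial in w, so f and S have the same smoothness and both are even.
   At a simple root of f exactly one F_s vanishes: otherwise the nonnegative
   function (F_+ - F_-)^2 = S^2 - 4 f has a minimum there, forcing f' = 0.  If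
   +-w_H are the only roots and are simple, f is negative exactly on
   (-w_H, w_H), whence no branch cut is met on [-w_H, w_H] and one branch has
   the sign pattern of class I.

   For the crossings, implicit differentiation of p(lambda, e^(-lambda tau)) = 0
   at lambda = i w_H gives lambda' = lambda / (q - tau) with
   q = p_lambda / (Y p_Y), and F_j'(w_H) = 2 Im q > 0, so that
   Re lambda' = w_H Im q / |q - tau|^2 > 0 for every delay tau. *)
Require Import Defs.
From mathcomp Require Import all_boot all_order all_algebra.
From mathcomp.real_closed Require Import complex.
From mathcomp Require Import all_classical all_reals all_analysis.
From mathcomp Require Import ring lra.
Import Order.TTheory GRing.Theory Num.Theory.
Import numFieldNormedType.Exports.
Set Implicit Arguments.
Unset Strict Implicit.
Unset Printing Implicit Defensive.
Local Open Scope classical_set_scope.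
Local Open Scope ring_scope.
Local Open Scope complex_scope.

(** Outside [-w_H, w_H] the discriminant z may lie on the cut of the square root, so the branches
    cannot be followed there by continuity. The signs of both factors are read instead from f and S,
    which are continuous everywhere and positive at arbitrarily large w. On [-w_H, w_H], meeting the
    cut would produce a point of the interval where F_+ = F_-, hence where f is a square; this
    contradicts f < 0 inside and simplicity at the endpoints. A crossing is an arbitrary continuous
    family of roots: its speed has to be determined for every such family, and an existing one must
    be continuous at all nearby delays. Both follow from an exact increment formula for the
    characteristic function. Since Im q > 0 and tau is real, q - tau never vanishes: the imaginary
    root is simple at every delay, so one implicit function argument serves all tau_k. From class I
    to simple roots, transversality supplies the derivative that the sign conditions leave open. The
    factor that does not vanish is known only to be continuous there, so the derivative of the
    product is computed from quotients at a zero. *)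

Local Notation Re := complex.Re.
Local Notation Im := complex.Im.
Local Notation normc := ComplexField.Normc.normc.

(** * Limits in the complex plane *)

Section ComplexLimits.
Variable R : realType.
Implicit Types (l m : R[i]).

Lemma complex_eqP (u v : R[i]) : u = v <-> Re u = Re v /\ Im u = Im v.
Proof. by split=> [->//|]; case: u v => a b [c d] /= [-> ->]. Qed.

Lemma normc_sqr (u : R[i]) : normc u ^+ 2 = Re u ^+ 2 + Im u ^+ 2.
Proof. by case: u => a b /=; rewrite sqr_sqrtr // addr_ge0 ?sqr_ge0. Qed.

Lemma normc_ge0 (u : R[i]) : 0 <= normc u.
Proof. by case: u => a b /=; exact: sqrtr_ge0. Qed.

Lemma normc_eq0 (u : R[i]) : (normc u == 0) = (u == 0).
Proof.
apply/eqP/eqP => [|->]; first exact: ComplexField.Normc.eq0_normc.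
exact: ComplexField.Normc.normc0.
Qed.

Lemma normc_gt0 (u : R[i]) : (0 < normc u) = (u != 0).
Proof. by rewrite lt_def normc_ge0 andbT normc_eq0. Qed.

Lemma normcD_le (u v : R[i]) : normc (u + v) <= normc u + normc v.
Proof. exact: le_normcD. Qed.

Lemma normc_opp (u : R[i]) : normc (- u) = normc u.
Proof. exact: normcN. Qed.

Lemma normcB_le (u v : R[i]) : normc (u - v) <= normc u + normc v.
Proof. by rewrite -(normc_opp v) normcD_le. Qed.

Lemma ler_Re_normc (u : R[i]) : `|Re u| <= normc u.
Proof.
by rewrite -(ler_pXn2r (n := 2)) ?nnegrE ?normc_ge0 // normc_sqr
  real_normK ?num_real // lerDl sqr_ge0.
Qed.

Lemma ler_Im_normc (u : R[i]) : `|Im u| <= normc u.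
Proof.
by rewrite -(ler_pXn2r (n := 2)) ?nnegrE ?normc_ge0 // normc_sqr
  real_normK ?num_real // lerDr sqr_ge0.
Qed.

Lemma normc_le_ReIm (u : R[i]) : normc u <= `|Re u| + `|Im u|.
Proof.
rewrite -(ler_pXn2r (n := 2)) ?nnegrE ?normc_ge0 ?addr_ge0 // normc_sqr.
rewrite sqrrD !real_normK ?num_real // lerD2r lerDl.
by rewrite mulrn_wge0 // mulr_ge0.
Qed.

Lemma normc_real (x : R) : normc x%:C = `|x|.
Proof. by rewrite /= expr0n addr0 sqrtr_sqr. Qed.

(* Componentwise, because [R[i]] is not used as a topological space. *)
Definition ccvg (T : Type) (F : set_system T) (f : T -> R[i]) l : Prop :=
  (Re (f t) @[t --> F] --> Re l) /\ (Im (f t) @[t --> F] --> Im l).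

Section Filter.
Variables (T : Type) (F : set_system T).
Context {FF : Filter F}.
Implicit Types (f g : T -> R[i]) (x : T -> R).

Lemma ccvg_cst l : ccvg F (fun=> l) l.
Proof. by split; exact: cvg_cst. Qed.

Lemma ccvg_complex x y (a b : R) : x t @[t --> F] --> a -> y t @[t --> F] --> b ->
  ccvg F (fun t => x t +i* y t) (a +i* b).
Proof. by []. Qed.

Lemma ccvg_real x (a : R) : x t @[t --> F] --> a -> ccvg F (fun t => (x t)%:C) a%:C.
Proof. by move=> xa; split => //=; exact: cvg_cst. Qed.

Lemma ccvgN f l : ccvg F f l -> ccvg F (fun t => - f t) (- l).
Proof.
move=> [h1 h2]; split.
  by under eq_fun do rewrite raddfN; rewrite raddfN; exact: cvgN.
by under eq_fun do rewrite raddfN; rewrite raddfN; exact: cvgN.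
Qed.

Lemma ccvgD f g l m : ccvg F f l -> ccvg F g m ->
  ccvg F (fun t => f t + g t) (l + m).
Proof.
move=> [h1 h2] [k1 k2]; split.
  by under eq_fun do rewrite raddfD; rewrite raddfD; exact: cvgD.
by under eq_fun do rewrite raddfD; rewrite raddfD; exact: cvgD.
Qed.

Lemma ccvgB f g l m : ccvg F f l -> ccvg F g m ->
  ccvg F (fun t => f t - g t) (l - m).
Proof. by move=> h k; apply: ccvgD => //; exact: ccvgN. Qed.

Lemma ReM (u v : R[i]) : Re (u * v) = Re u * Re v - Im u * Im v.
Proof. by case: u v => a b [c d]. Qed.

Lemma ImM (u v : R[i]) : Im (u * v) = Re u * Im v + Im u * Re v.
Proof. by case: u v => a b [c d]. Qed.

Lemma ccvgM f g l m : ccvg F f l -> ccvg F g m ->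
  ccvg F (fun t => f t * g t) (l * m).
Proof.
move=> [h1 h2] [k1 k2]; split.
  under eq_fun do rewrite ReM; rewrite ReM.
  by apply: cvgB; exact: cvgM.
under eq_fun do rewrite ImM; rewrite ImM.
by apply: cvgD; exact: cvgM.
Qed.

Lemma cvg_normc f l : ccvg F f l -> normc (f t) @[t --> F] --> normc l.
Proof.
move=> [h1 h2].
have normE (u : R[i]) : normc u = Num.sqrt (Re u ^+ 2 + Im u ^+ 2) by case: u.
under eq_fun do rewrite normE; rewrite normE.
apply: (@continuous_cvg _ _ _ _ _ (fun t => Re (f t) ^+ 2 + Im (f t) ^+ 2)
          (@Num.sqrt R) _); first exact: sqrt_continuous.
by apply: cvgD; apply: (@continuous_cvg _ _ _ _ _ _ (fun z : R => z ^+ 2)) => //;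
  exact: exprn_continuous.
Qed.

Lemma ccvg_normc0 f l : normc (f t - l) @[t --> F] --> (0 : R) -> ccvg F f l.
Proof.
move=> h.
have key (p : R[i] -> R) : (forall u v, p (u - v) = p u - p v) ->
    (forall u, `|p u| <= normc u) -> p (f t) @[t --> F] --> p l.
  move=> pB pn; apply/cvgrPdist_le => e e0.
  have /cvgrPdist_le/(_ e e0) := h.
  apply: filterS => t; rewrite sub0r normrN ger0_norm ?normc_ge0 //.
  by apply: le_trans; rewrite distrC -pB.
split; apply: key => //; try exact: raddfB.
  exact: ler_Re_normc.
exact: ler_Im_normc.
Qed.

Lemma ccvgV f l : l != 0 -> ccvg F f l -> ccvg F (fun t => (f t)^-1) l^-1.
Proof.
move=> l0 fl; have [h1 h2] := fl.
have ReV (u : R[i]) : Re u^-1 = Re u / normc u ^+ 2.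
  by rewrite normc_sqr; case: u.
have ImV (u : R[i]) : Im u^-1 = - Im u / normc u ^+ 2.
  by rewrite normc_sqr; case: u => a b /=; rewrite mulNr.
have n2 : (normc (f t) ^+ 2)^-1 @[t --> F] --> (normc l ^+ 2)^-1.
  apply: cvgV; first by rewrite expf_eq0 /= normc_eq0.
  apply: (@continuous_cvg _ _ _ _ _ _ (fun z : R => z ^+ 2)).
    exact: exprn_continuous.
  exact: cvg_normc.
split.
  by under eq_fun do rewrite ReV; rewrite ReV; exact: cvgM.
by under eq_fun do rewrite ImV; rewrite ImV; apply: cvgM => //; exact: cvgN.
Qed.

Lemma ccvg_cexp f l : ccvg F f l -> ccvg F (fun t => cexp (f t)) (cexp l).
Proof.
move=> [h1 h2].
have hE : expR (Re (f t)) @[t --> F] --> expR (Re l).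
  by apply: continuous_cvg => //; exact: continuous_expR.
split => /=; apply: cvgM => //.
  by apply: continuous_cvg => //; exact: continuous_cos.
by apply: continuous_cvg => //; exact: continuous_sin.
Qed.

End Filter.

Lemma cexpD (u v : R[i]) : cexp (u + v) = cexp u * cexp v.
Proof.
case: u v => a b [c d]; rewrite /cexp /= expRD cosD sinD.
by apply/complex_eqP => /=; split; ring.
Qed.

End ComplexLimits.

(** The derivatives of [alpha] and of a modulus factor are both found as the real part of a limit of
    complex quotients; this form connects them with [is_derive]. *)
Lemma is_derive1_quotP (R : realType) (f : R -> R) (x a : R) :
  is_derive x 1 f a <-> (f z - f x) / (z - x) @[z --> x^'] --> a.
Proof.
split=> [/is_derive1_caratheodory [g [fE gc <-]]|h].
  have /continuous_withinNx := gc; apply: cvg_trans; apply: near_eq_cvg.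
  near=> z; rewrite fE mulfK // subr_eq0; near: z.
  exact: nbhs_dnbhs_neq.
apply/is_derive1_caratheodory.
exists (fun z => if z == x then a else (f z - f x) / (z - x)); split.
- move=> z; case: eqP => [->|/eqP]; first by rewrite !subrr mulr0.
  by rewrite -subr_eq0 => /divfK->.
- apply/continuous_withinNx; rewrite eqxx.
  apply: cvg_trans h; apply: near_eq_cvg; near=> z.
  case: eqP => // zx; suff : z != x by rewrite zx eqxx.
  by near: z; exact: nbhs_dnbhs_neq.
by rewrite eqxx.
Unshelve. all: by end_near. Qed.

(** * An implicit function theorem in one complex variable *)

(* [F] is given with difference quotients [Phi] and [Psi] that converge when
   both points tend to [(l0, t0)]; this strict differentiability yields
   continuity of the solution at nearby parameters too. *)
Section ImplicitFunction.
Variable R : realType.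
Variables (F : R[i] -> R -> R[i]) (Phi Psi : R[i] -> R -> R[i] -> R -> R[i]).
Variables (l0 : R[i]) (t0 : R) (D D' : R[i]).

Hypothesis F_incr : forall l1 t1 l2 t2, F l1 t1 - F l2 t2 =
  Phi l1 t1 l2 t2 * (l1 - l2) + Psi l1 t1 l2 t2 * (t1 - t2)%:C.
Let incr_cvg (G : R[i] -> R -> R[i] -> R -> R[i]) (d : R[i]) :=
  forall (T : Type) (H : set_system T), Filter H ->
  forall (l1 l2 : T -> R[i]) (t1 t2 : T -> R),
    ccvg H l1 l0 -> ccvg H l2 l0 -> t1 @ H --> t0 -> t2 @ H --> t0 ->
    ccvg H (fun x => G (l1 x) (t1 x) (l2 x) (t2 x)) d.
Hypotheses (PhiD : incr_cvg Phi D) (PsiD : incr_cvg Psi D').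
Hypotheses (D0 : D != 0) (F0 : F l0 t0 = 0).

(** Along zeros the increment identity reads 0 = Phi (l - l0) + Psi (t - t0), so the quotient of l
    is exactly - Psi / Phi. The family is arbitrary because the speed of every crossing is needed,
    not only of the constructed one. *)
Lemma implicit_derive (alpha beta : R -> R) :
  {for t0, continuous alpha} -> {for t0, continuous beta} ->
  alpha t0 +i* beta t0 = l0 ->
  (\forall t \near t0, F (alpha t +i* beta t) t = 0) ->
  is_derive t0 1 alpha (Re (- D' / D)).
Proof.
move=> ca cb ab0 Fab; apply/is_derive1_quotP.
pose l t := alpha t +i* beta t.
have lc : ccvg t0^' l l0.
  rewrite -ab0; apply: ccvg_complex.
    by apply: cvg_trans ca; apply: cvg_app; exact: nbhs_dnbhs.
  by apply: cvg_trans cb; apply: cvg_app; exact: nbhs_dnbhs.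
have tc : id t @[t --> t0^'] --> t0 by exact: nbhs_dnbhs.
have lc0 : ccvg t0^' (fun=> l0) l0 by exact: ccvg_cst.
have tc0 : (fun=> t0) t @[t --> t0^'] --> t0 by exact: cvg_cst.
have hPhi := PhiD (T := R) (H := t0^') (dnbhs_filter t0) lc lc0 tc tc0.
have hPsi := PsiD (T := R) (H := t0^') (dnbhs_filter t0) lc lc0 tc tc0.
have [+ _] : ccvg t0^' (fun t => - Psi (l t) t l0 t0 / Phi (l t) t l0 t0) (- D' / D).
  exact: (ccvgM (ccvgN hPsi) (ccvgV D0 hPhi)).
apply: cvg_trans; apply: near_eq_cvg; near=> t.
have P0 : Phi (l t) t l0 t0 != 0.
  rewrite -normc_gt0; near: t.
  by apply: (cvgr_gt _ (cvg_normc hPhi)); rewrite normc_gt0.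
have tt0 : (t - t0)%:C != 0.
  rewrite fmorph_eq0 subr_eq0; near: t; exact: nbhs_dnbhs_neq.
have -> : - Psi (l t) t l0 t0 / Phi (l t) t l0 t0 = (l t - l0) * ((t - t0)^-1)%:C.
  have := F_incr (l t) t l0 t0; rewrite F0 subr0.
  have -> : F (l t) t = 0.
    by near: t; apply: nbhs_dnbhs; exact: Fab.
  move=> /eqP; rewrite eq_sym addr_eq0 => /eqP e.
  apply/(mulIf P0)/(mulIf tt0).
  rewrite divfK // -mulNr in e *.
  rewrite fmorphV /=; apply: etrans (esym e) _.
  by field; move: tt0; rewrite rmorphB.
rewrite ReM /= mulr0 subr0; congr (_ * _).
by rewrite -ab0 raddfB.
Unshelve. all: by end_near. Qed.

(** Convergence is assumed along every filter; applied to the filter generated by the boxes [B d] in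
    all four arguments, it becomes a bound uniform on one box. *)
Let incr_bound : exists2 d : R, 0 < d & forall l1 t1 l2 t2,
  normc (l1 - l0) < d -> normc (l2 - l0) < d -> `|t1 - t0| < d -> `|t2 - t0| < d ->
  normc (Phi l1 t1 l2 t2 - D) <= normc D / 2 /\
  normc (Psi l1 t1 l2 t2) <= normc D' + 1.
Proof.
pose T := (R[i] * R * (R[i] * R))%type.
pose B (d : R) : set T := [set x | [/\ normc (x.1.1 - l0) < d,
  normc (x.2.1 - l0) < d, `|x.1.2 - t0| < d & `|x.2.2 - t0| < d]].
pose H := filter_from [set d : R | 0 < d] B.
have FH : Filter H.
  apply: filter_from_filter; first by exists 1 => /=.
  move=> d e d0 e0; exists (Num.min d e); first by rewrite /= lt_min d0.
  by move=> x [/= h1 h2 h3 h4]; split; split; move: h1 h2 h3 h4;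
    rewrite !lt_min => /andP[? ?] /andP[? ?] /andP[? ?] /andP[? ?].
have Hsmall (g : T -> R) (y : R) : (forall d x, B d x -> `|y - g x| <= d) ->
    g x @[x --> H] --> y.
  move=> hg; apply/cvgrPdist_le => e e0; exists e => // x; exact: hg.
have h1 : ccvg H (fun x : T => x.1.1) l0.
  apply: ccvg_normc0; apply: Hsmall => d x [/ltW h _ _ _].
  by rewrite sub0r normrN ger0_norm ?normc_ge0.
have h2 : ccvg H (fun x : T => x.2.1) l0.
  apply: ccvg_normc0; apply: Hsmall => d x [_ /ltW h _ _].
  by rewrite sub0r normrN ger0_norm ?normc_ge0.
have h3 : x.1.2 @[x --> H] --> t0.
  by apply: Hsmall => d x [_ _ /ltW h _]; rewrite distrC.
have h4 : x.2.2 @[x --> H] --> t0.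
  by apply: Hsmall => d x [_ _ _ /ltW h]; rewrite distrC.
have hPhi := PhiD FH h1 h2 h3 h4.
have hPsi := PsiD FH h1 h2 h3 h4.
have D2 : 0 < normc D / 2 by rewrite divr_gt0 // normc_gt0.
have e1 : \forall x \near H, normc (Phi x.1.1 x.1.2 x.2.1 x.2.2 - D) <= normc D / 2.
  have : normc (Phi x.1.1 x.1.2 x.2.1 x.2.2 - D) @[x --> H] --> normc (D - D).
    by apply: cvg_normc; apply: ccvgB => //; exact: ccvg_cst.
  rewrite subrr ComplexField.Normc.normc0 => /cvgrPdist_le /(_ _ D2).
  by apply: filterS => x; rewrite sub0r normrN ger0_norm ?normc_ge0.
have e2 : \forall x \near H, normc (Psi x.1.1 x.1.2 x.2.1 x.2.2) <= normc D' + 1.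
  have : normc (Psi x.1.1 x.1.2 x.2.1 x.2.2) @[x --> H] --> normc D' by exact: cvg_normc.
  move=> /cvgrPdist_le /(_ _ ltr01); apply: filterS => x.
  by rewrite distrC => /(le_trans (ler_norm _)); rewrite lerBlDr addrC.
have [d d0 Bd] := filterI e1 e2.
exists d => // l1 t1 l2 t2 k1 k2 k3 k4.
by have [] := Bd ((l1, t1), (l2, t2)) (And4 k1 k2 k3 k4).
Qed.

Lemma implicit_function : exists alpha beta : R -> R,
  [/\ alpha t0 +i* beta t0 = l0
    & \forall t \near t0, [/\ {for t, continuous alpha},
        {for t, continuous beta} & F (alpha t +i* beta t) t = 0]].
Proof.
have [d d0 bnd] := incr_bound.
set nD := normc D in bnd *; set M := normc D' + 1 in bnd.
have nD0 : 0 < nD by rewrite normc_gt0.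
have M0 : 0 < M by rewrite ltr_wpDl ?normc_ge0.
have Phi_ge l1 t1 l2 t2 : normc (l1 - l0) < d -> normc (l2 - l0) < d ->
    `|t1 - t0| < d -> `|t2 - t0| < d -> nD / 2 <= normc (Phi l1 t1 l2 t2).
  move=> k1 k2 k3 k4; have [+ _] := bnd _ _ _ _ k1 k2 k3 k4.
  have := normcB_le (Phi l1 t1 l2 t2) (Phi l1 t1 l2 t2 - D).
  by rewrite opprB addrC subrK -/nD; set u := normc _; set v := normc _; lra.
have nRe (x : R) : normc x%:C = `|x| by exact: normc_real.
(* This inequality serves three times: it keeps a minimiser of |F(., t)| off the boundary, makes the
   solution Lipschitz in t, and identifies its value at [t0]. *)
have dist_le l1 t1 l2 t2 : normc (l1 - l0) < d -> normc (l2 - l0) < d ->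
    `|t1 - t0| < d -> `|t2 - t0| < d ->
    nD / 2 * normc (l1 - l2) <= normc (F l1 t1 - F l2 t2) + M * `|t1 - t2|.
  move=> k1 k2 k3 k4; have [_ hPsi] := bnd _ _ _ _ k1 k2 k3 k4.
  have hPhi := Phi_ge _ _ _ _ k1 k2 k3 k4.
  have -> : F l1 t1 - F l2 t2 = Phi l1 t1 l2 t2 * (l1 - l2) + Psi l1 t1 l2 t2 * (t1 - t2)%:C.
    exact: F_incr.
  set a := _ * (l1 - l2); set b := _ * (t1 - t2)%:C.
  have : normc a <= normc (a + b) + normc b.
    by rewrite -{1}(addrK b a) normcB_le.
  have : normc b <= M * `|t1 - t2|.
    by rewrite ComplexField.Normc.normcM nRe ler_wpM2r.
  have : nD / 2 * normc (l1 - l2) <= normc a.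
    by rewrite ComplexField.Normc.normcM ler_wpM2r // normc_ge0.
  lra.
pose r := d / 4.
have r0 : 0 < r by rewrite divr_gt0.
(* At a minimiser c, [dist_le] gives nD / 2 |c - l0| <= 2 |F(l0, t)| <= 2 M |t - t0|. The bound nD r
   / (8 M) thus puts c within r / 2 of [l0], while r = d / 4 keeps the whole square in the ball of
   radius d. *)
pose rho := Num.min d (nD * r / (8 * M)).
have rho0 : 0 < rho by rewrite lt_min d0 divr_gt0 ?mulr_gt0.
have l0d : normc (l0 - l0) < d by rewrite subrr ComplexField.Normc.normc0.
have t0d : `|t0 - t0| < d by rewrite subrr normr0.
have sol t : `|t - t0| < rho -> exists l, normc (l - l0) < d /\ F l t = 0.
  rewrite lt_min => /andP[td tM].
  (* A zero is found by minimising |F(., t)| over a small square: at an interior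
     minimum, a step in the direction - F / D would decrease |F|. *)
  pose S := `[Re l0 - r, Re l0 + r] `*` `[Im l0 - r, Im l0 + r] : set (R * R).
  have S_d x y : S (x, y) -> normc (x +i* y - l0) < d.
    move=> [/=]; rewrite !in_itv /= => /andP[x1 x2] /andP[y1 y2].
    apply: le_lt_trans (normc_le_ReIm _) _.
    have k1 : `|Re (x +i* y - l0)| <= r.
      by rewrite raddfB ler_norml /=; apply/andP; split; lra.
    have k2 : `|Im (x +i* y - l0)| <= r.
      by rewrite raddfB ler_norml /=; apply/andP; split; lra.
    move: k1 k2 (d0); rewrite /r; lra.
  have d_S l : normc (l - l0) <= r -> S (Re l, Im l).
    move=> lr; have := le_trans (ler_Re_normc _) lr.
    have := le_trans (ler_Im_normc _) lr.
    rewrite !raddfB /= !ler_norml => /andP[? ?] /andP[? ?].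
    by split; rewrite /= in_itv /=; apply/andP; split; lra.
  pose g (p : R * R) := normc (F (p.1 +i* p.2) t).
  have gc : {within S, continuous g}.
    apply: continuous_in_subspaceT => -[x y]; rewrite inE => Sxy.
    have Sd := S_d _ _ Sxy.
    pose G := nbhs ((x, y) : R * R).
    have c1 : ccvg G (fun p : R * R => p.1 +i* p.2) (x +i* y).
      by apply: ccvg_complex; [exact: cvg_fst|exact: cvg_snd].
    have c2 : \forall p \near G, normc (p.1 +i* p.2 - l0) < d.
      exact: (cvgr_lt _ (cvg_normc (ccvgB c1 (ccvg_cst (F := G) l0))) _ Sd).
    apply: cvg_normc; apply: ccvg_normc0.
    have c3 : normc (p.1 +i* p.2 - (x +i* y)) * (2 * nD) @[p --> G] --> (0 : R).
      rewrite -[X in _ --> X](mul0r (2 * nD)).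
      apply: cvgM; last exact: cvg_cst.
      have : normc (p.1 +i* p.2 - (x +i* y)) @[p --> G] --> normc (x +i* y - (x +i* y)).
        by apply: cvg_normc; apply: ccvgB => //; exact: ccvg_cst.
      by rewrite subrr ComplexField.Normc.normc0.
    apply: (squeeze_cvgr _ (cvg_cst 0) c3).
    apply: filterS c2 => -[x' y'] /= k; rewrite normc_ge0 /=.
    rewrite F_incr subrr /= mulr0 addr0 ComplexField.Normc.normcM mulrC ler_wpM2l ?normc_ge0 //.
    have [+ _] := bnd _ _ _ _ k Sd td td.
    have := normcD_le (Phi (x' +i* y') t (x +i* y) t - D) D.
    by rewrite subrK -/nD; set u := normc _; set v := normc _; lra.
  have S0 : S !=set0.
    exists (Re l0, Im l0); apply: d_S; by rewrite subrr ComplexField.Normc.normc0 ltW.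
  have Sc : compact S by apply: compact_setX; exact: segment_compact.
  have [[x y]] := compact_EVT_min S0 Sc gc.
  rewrite inE => Sxy gmin.
  pose c := x +i* y; exists c; split; first exact: S_d.
  have cd : normc (c - l0) < d by exact: S_d.
  have gmin' l : normc (l - l0) <= r -> normc (F c t) <= normc (F l t).
    by move=> /d_S Sl; have := gmin (Re l, Im l); rewrite /g /= inE => /(_ Sl); case: l {Sl}.
  have Fl0 : normc (F l0 t) <= M * `|t - t0|.
    have := F_incr l0 t l0 t0; rewrite F0 subr0 subrr mulr0 add0r => ->.
    rewrite ComplexField.Normc.normcM nRe ler_wpM2r //.
    by have [] := bnd _ _ _ _ l0d l0d td t0d.
  have Mt : M * `|t - t0| < nD * r / 8.
    move: tM; rewrite invfM mulrA ltr_pdivlMr // mulrC.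
    by rewrite (mulrC _ 8^-1) mulrC.
  have cr : normc (c - l0) < r.
    have := dist_le _ _ _ _ cd l0d td td; rewrite subrr normr0 mulr0 addr0.
    have := normcB_le (F c t) (F l0 t).
    have rr : normc (l0 - l0) <= r by rewrite subrr ComplexField.Normc.normc0 ltW.
    have := gmin' _ rr.
    set u := normc _; set v := normc _; set w := normc _; set z := normc _.
    move=> k1 k2 k3; rewrite -(ltr_pM2l nD0); move: Mt Fl0 k1 k2 k3; rewrite -/v.
    by have := mulr_gt0 nD0 r0; set e := nD * r; lra.
  apply/eqP; rewrite -normc_eq0 -[_ == 0]negbK; apply/negP.
  rewrite normc_eq0 -normc_gt0 => Fc0.
  (* A step of relative size s multiplies F by 1 - s Phi / D. As |Phi / D - 1| <= 1 / 2, its modulus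
     is at most (1 - s) + s / 2 < 1. The second bound on s keeps the new point within r of [l0]. *)
  pose s := Num.min (2^-1) ((r - normc (c - l0)) * nD / normc (F c t)).
  have s0 : 0 < s by rewrite lt_min invr_gt0 ltr0n divr_gt0 // mulr_gt0 // subr_gt0.
  have s1 : s <= 2^-1 by rewrite ge_min lexx.
  have s2 : s * normc (F c t) / nD <= r - normc (c - l0).
    by rewrite ler_pdivrMr // -ler_pdivlMr // ge_min lexx orbT.
  pose h := - (s%:C * F c t / D); pose l := c + h.
  have nh : normc h = s * normc (F c t) / nD.
    by rewrite normc_opp !ComplexField.Normc.normcM ComplexField.Normc.normcV nRe gtr0_norm.
  have lr : normc (l - l0) <= r.
    rewrite /l addrAC; apply: le_trans (normcD_le _ _) _; rewrite nh; lra.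
  have ld : normc (l - l0) < d by apply: le_lt_trans lr _; rewrite /r; lra.
  have := gmin' _ lr; rewrite leNgt => /negP; apply.
  have FlE : F l t = F c t * (1 - s%:C * (Phi l t c t / D)).
    have := F_incr l t c t; rewrite subrr mulr0 addr0 => /eqP.
    have -> : l - c = h by rewrite /l addrC addKr.
    by rewrite subr_eq => /eqP ->; rewrite /h; field.
  rewrite FlE ComplexField.Normc.normcM -{2}(mulr1 (normc (F c t))) ltr_pM2l //.
  have -> : 1 - s%:C * (Phi l t c t / D) = (1 - s)%:C - s%:C * ((Phi l t c t - D) / D).
    by rewrite rmorphB rmorph1; field.
  apply: le_lt_trans (normcB_le _ _) _.
  rewrite !ComplexField.Normc.normcM ComplexField.Normc.normcV !nRe (gtr0_norm s0) ger0_norm; last lra.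
  have [+ _] := bnd _ _ _ _ ld cd td td; rewrite -/nD => k.
  have : normc (Phi l t c t - D) / nD <= 2^-1 by rewrite ler_pdivrMr // mulrC.
  set u := _ / nD; move=> k2.
  have := ler_wpM2l (ltW s0) k2; lra.
(* Any choice of zeros will do: [dist_le] makes it Lipschitz on the whole neighbourhood, hence
   continuous at every nearby t. *)
pose lam t := xget l0 [set l | normc (l - l0) < d /\ F l t = 0].
have lamP t : `|t - t0| < rho -> normc (lam t - l0) < d /\ F (lam t) t = 0.
  by move=> tr; apply: (@xgetPex _ l0 [set l | normc (l - l0) < d /\ F l t = 0]); exact: sol.
have rhod t : `|t - t0| < rho -> `|t - t0| < d by rewrite lt_min => /andP[].
have lip t s : `|t - t0| < rho -> `|s - t0| < rho ->
    normc (lam t - lam s) <= 2 * M / nD * `|t - s|.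
  move=> tr sr; have [k1 e1] := lamP _ tr; have [k2 e2] := lamP _ sr.
  have := dist_le _ _ _ _ k1 k2 (rhod _ tr) (rhod _ sr).
  rewrite e1 e2 subrr ComplexField.Normc.normc0 add0r => k.
  by rewrite mulrAC ler_pdivlMr //; move: k; lra.
have lamc t : `|t - t0| < rho -> ccvg (nbhs t) lam (lam t).
  move=> tr; apply: ccvg_normc0.
  have c3 : 2 * M / nD * `|s - t| @[s --> t] --> (0 : R).
    rewrite -[X in _ --> X](mulr0 (2 * M / nD)); apply: cvgM; first exact: cvg_cst.
    have : `|s - t| @[s --> t] --> `|t - t|.
      by apply: cvg_norm; apply: cvgB; [exact: cvg_id|exact: cvg_cst].
    by rewrite subrr normr0.
  apply: (squeeze_cvgr _ (cvg_cst 0) c3).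
  have : \forall s \near t, `|s - t0| < rho.
    have : `|s - t0| @[s --> t] --> `|t - t0|.
      by apply: cvg_norm; apply: cvgB; [exact: cvg_id|exact: cvg_cst].
    by move=> /cvgr_lt/(_ _ tr).
  by apply: filterS => s sr; rewrite normc_ge0 lip.
have t0r : `|t0 - t0| < rho by rewrite subrr normr0.
have lam0 : lam t0 = l0.
  have [k1 e1] := lamP _ t0r.
  have := dist_le _ _ _ _ k1 l0d t0d t0d.
  rewrite e1 F0 subrr ComplexField.Normc.normc0 add0r subrr normr0 mulr0 => k.
  apply/eqP; rewrite -subr_eq0 -normc_eq0 eq_le normc_ge0 andbT.
  by rewrite -(pmulr_rle0 _ (divr_gt0 nD0 (ltr0Sn R 1))).
have lamE t : Re (lam t) +i* Im (lam t) = lam t by case: (lam t).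
exists (fun t => Re (lam t)), (fun t => Im (lam t)); rewrite lamE; split=> //.
have : \forall t \near t0, `|t - t0| < rho.
  have : `|s - t0| @[s --> t0] --> `|t0 - t0|.
    by apply: cvg_norm; apply: cvgB; [exact: cvg_id|exact: cvg_cst].
  by move=> /cvgr_lt/(_ _ t0r).
apply: filterS => t tr; rewrite lamE; have [c1 c2] := lamc _ tr.
by split=> //; have [] := lamP _ tr.
Qed.

End ImplicitFunction.

(** * The characteristic function *)

Section ComplexExponential.
Variable R : realType.

Lemma cexp0 : cexp 0 = 1 :> R[i].
Proof. by apply/complex_eqP; rewrite /= expR0 cos0 sin0 !mul1r. Qed.

(** The divided difference of the exponential, with the derivative on the diagonal so that it is
    continuous there. *)
Definition cexp_quot (u v : R[i]) : R[i] :=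
  if u == v then cexp v else (cexp u - cexp v) / (u - v).

Lemma cexp_quotP (u v : R[i]) : cexp u - cexp v = cexp_quot u v * (u - v).
Proof.
rewrite /cexp_quot; case: eqP => [->|/eqP uv]; first by rewrite !subrr mulr0.
by rewrite divfK // subr_eq0.
Qed.

(** Factoring out [cexp v] leaves (e^h - 1) / h with h = u - v tending to 0. The real slope
    functions E, C, S of exp, cos and sin at 0 give e^h - 1 = h + (Re h) w + (Im h) z with w and z
    tending to 0, and |Re h|, |Im h| <= |h|. *)
Lemma cexp_quot_cvg (T : Type) (F : set_system T) {FF : Filter F}
    (u v : T -> R[i]) (l : R[i]) :
  ccvg F u l -> ccvg F v l -> ccvg F (fun t => cexp_quot (u t) (v t)) (cexp l).
Proof.
move=> ul vl.
have /is_derive1_caratheodory [E [EE Ec E0]] := is_derive_expR (0 : R).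
have /is_derive1_caratheodory [C [CE Cc C0]] := is_derive_cos (0 : R).
have /is_derive1_caratheodory [S [SE Sc S0]] := is_derive_sin (0 : R).
have {}Ec : E z @[z --> (0 : R)] --> (1 : R).
  by have := Ec; rewrite /prop_for /continuous_at E0 expR0.
have {}Cc : C z @[z --> (0 : R)] --> (0 : R).
  by have := Cc; rewrite /prop_for /continuous_at C0 sin0 oppr0.
have {}Sc : S z @[z --> (0 : R)] --> (1 : R).
  by have := Sc; rewrite /prop_for /continuous_at S0 cos0.
pose h t := u t - v t.
have h0 : ccvg F h 0 by rewrite -(subrr l); exact: ccvgB.
have [h1 h2] := h0.
pose w t := (E (Re (h t)))%:C * (cos (Im (h t)) +i* sin (Im (h t))) - 1.
pose z t := C (Im (h t)) +i* S (Im (h t)) - 'i.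
have w0 : ccvg F w 0.
  have -> : 0 = 1%:C * (cos 0 +i* sin 0) - 1 :> R[i].
    by rewrite cos0 sin0; apply/complex_eqP; split=> /=; ring.
  apply: ccvgB; last exact: ccvg_cst.
  apply: ccvgM; first by apply: ccvg_real; exact: (cvg_comp _ _ h1 Ec).
  apply: ccvg_complex.
    exact: (cvg_comp _ _ h2 (@continuous_cos R 0)).
  exact: (cvg_comp _ _ h2 (@continuous_sin R 0)).
have z0 : ccvg F z 0.
  have -> : 0 = 0 +i* 1 - 'i :> R[i] by apply/complex_eqP; split=> /=; ring.
  apply: ccvgB; last exact: ccvg_cst.
  apply: ccvg_complex.
    exact: (cvg_comp _ _ h2 Cc).
  exact: (cvg_comp _ _ h2 Sc).
have psiE t : cexp_quot (h t) 0 * h t = h t + (Re (h t))%:C * w t + (Im (h t))%:C * z t.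
  rewrite -[X in _ * X]subr0 -cexp_quotP cexp0 /w /z.
  have := SE (Im (h t)); have := CE (Im (h t)); have := EE (Re (h t)).
  rewrite expR0 cos0 sin0 !subr0; case: (h t) => x y /=.
  move=> /eqP; rewrite subr_eq => /eqP e1 /eqP; rewrite subr_eq => /eqP e2 e3.
  apply/complex_eqP; split => /=; rewrite ?e1 ?e2 ?e3; simpc; rewrite /= ?e2 ?e3.
    by ring.
  by ring.
have psi1 : ccvg F (fun t => cexp_quot (h t) 0) 1.
  apply: ccvg_normc0.
  have c3 : normc (w t) + normc (z t) @[t --> F] --> (0 : R).
    have -> : 0 = normc (0 : R[i]) + normc (0 : R[i]).
      by rewrite ComplexField.Normc.normc0 addr0.
    by apply: cvgD; exact: cvg_normc.
  apply: (squeeze_cvgr _ (cvg_cst 0) c3); near=> t; rewrite normc_ge0 /=.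
  have [ht0|ht0] := eqVneq (h t) 0.
    rewrite /cexp_quot ht0 eqxx cexp0 subrr ComplexField.Normc.normc0.
    by rewrite addr_ge0 ?normc_ge0.
  have nh : 0 < normc (h t) by rewrite normc_gt0.
  rewrite -(ler_pM2r nh) -ComplexField.Normc.normcM mulrBl psiE mul1r.
  have -> : h t + (Re (h t))%:C * w t + (Im (h t))%:C * z t - h t =
     (Re (h t))%:C * w t + (Im (h t))%:C * z t by ring.
  apply: le_trans (normcD_le _ _) _.
  rewrite !ComplexField.Normc.normcM !normc_real mulrDl.
  by apply: lerD; rewrite mulrC ler_wpM2l ?normc_ge0 ?ler_Re_normc ?ler_Im_normc.
have qE t : cexp_quot (u t) (v t) = cexp (v t) * cexp_quot (h t) 0.
  have -> : u t = h t + v t by rewrite /h subrK.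
  rewrite /cexp_quot addrK subr0 -subr_eq0 addrK cexp0.
  by case: eqP => _; rewrite ?mulr1 // cexpD; ring.
under eq_fun do rewrite qE.
by rewrite -[X in ccvg _ _ X]mulr1; apply: ccvgM => //; exact: ccvg_cexp.
Unshelve. all: by end_near. Qed.

End ComplexExponential.

(** * Increments of the characteristic function *)

Section CharacteristicFunction.
Variable R : realType.
Variables A B : 'M[R]_2.
Notation d := ((\det B)%:C).
Notation c := ((Defs.coefC A B)%:C).
Notation b := ((\tr B)%:C).

Lemma chardetE (lam Y : R[i]) : chardet A B lam Y =
  d * Y ^+ 2 + (c - lam * b) * Y + (lam ^+ 2 - lam * (\tr A)%:C + (\det A)%:C).
Proof.
rewrite /chardet /Defs.coefC /mxtrace !big_ord_recl !big_ord0 !addr0 !det_mx2 !mxE /=.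
have -> : lift ord0 ord0 = 1 :> 'I_2 by apply: val_inj.
have -> : ord0 = 0 :> 'I_2 by [].
rewrite /= !mulr1n !mulr0n !(rmorphD, rmorphB, rmorphM, rmorphN) /=.
by ring.
Qed.

Lemma conjc_cexp (u : R[i]) : (cexp u)^*%C = cexp (u^*%C).
Proof. by case: u => x y; rewrite /cexp /= cosN sinN mulrN. Qed.

Lemma conjc_chardet (lam Y : R[i]) :
  (chardet A B lam Y)^*%C = chardet A B (lam^*%C) (Y^*%C).
Proof.
rewrite !chardetE; case: lam Y => x y [x' y'].
by apply/complex_eqP; split => /=; simpc => /=; ring.
Qed.

Lemma char_root_conj (tau : R) (lam : R[i]) :
  char_root A B tau lam -> char_root A B tau (lam^*%C).
Proof.
rewrite /char_root => h.
have -> : - (tau%:C * lam^*%C) = (- (tau%:C * lam))^*%C.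
  by case: lam {h} => x y; simpc.
by rewrite -conjc_cexp -conjc_chardet h; simpc.
Qed.

Definition charfun (lam : R[i]) (tau : R) : R[i] :=
  chardet A B lam (cexp (- (tau%:C * lam))).

(* The factor shared by both difference quotients: the increment of the part of
   [charfun] depending on the exponential, divided by that of the exponent. *)
Definition cexp_part (l1 : R[i]) (t1 : R) (l2 : R[i]) (t2 : R) : R[i] :=
  let E1 := cexp (- (t1%:C * l1)) in let E2 := cexp (- (t2%:C * l2)) in
  (d * (E1 + E2) + c - l1 * b) * cexp_quot (- (t1%:C * l1)) (- (t2%:C * l2)).

Definition charfun_incr_lam (l1 : R[i]) (t1 : R) (l2 : R[i]) (t2 : R) : R[i] :=
  cexp_part l1 t1 l2 t2 * (- t1%:C)
  + (l1 + l2 - (\tr A)%:C - b * cexp (- (t2%:C * l2))).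

Definition charfun_incr_tau (l1 : R[i]) (t1 : R) (l2 : R[i]) (t2 : R) : R[i] :=
  cexp_part l1 t1 l2 t2 * (- l2).

(** The exponent changes by - t1 (l1 - l2) - l2 (t1 - t2); this asymmetric splitting is the origin
    of the factors [- t1] and [- l2] in the two quotients. *)
Lemma charfun_incr (l1 : R[i]) (t1 : R) (l2 : R[i]) (t2 : R) :
  charfun l1 t1 - charfun l2 t2 = charfun_incr_lam l1 t1 l2 t2 * (l1 - l2)
    + charfun_incr_tau l1 t1 l2 t2 * (t1 - t2)%:C.
Proof.
rewrite /charfun /charfun_incr_lam /charfun_incr_tau /cexp_part !chardetE rmorphB /=.
have := cexp_quotP (- (t1%:C * l1)) (- (t2%:C * l2)).
set q := cexp_quot _ _; set E1 := cexp _; set E2 := cexp _.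
move=> /eqP; rewrite subr_eq => /eqP ->; ring.
Qed.

Section Limits.
Variables (l0 : R[i]) (t0 : R) (T : Type) (H : set_system T).
Context {FH : Filter H}.
Variables (l1 l2 : T -> R[i]) (t1 t2 : T -> R).
Hypotheses (l1c : ccvg H l1 l0) (l2c : ccvg H l2 l0).
Hypotheses (t1c : t1 @ H --> t0) (t2c : t2 @ H --> t0).
Let Y := cexp (- (t0%:C * l0)).
(** [pY] and [plam] are the partial derivatives of [chardet] in its second and first argument at
    (l0, Y). *)
Let pY := 2 * d * Y + c - l0 * b.
Let plam := 2 * l0 - (\tr A)%:C - b * Y.

Let exponent_cvg (l : T -> R[i]) (t : T -> R) : ccvg H l l0 -> t @ H --> t0 ->
  ccvg H (fun x => - ((t x)%:C * l x)) (- (t0%:C * l0)).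
Proof. by move=> lc tc; apply: ccvgN; apply: ccvgM => //; exact: ccvg_real. Qed.

Let cexp_part_cvg :
  ccvg H (fun x => cexp_part (l1 x) (t1 x) (l2 x) (t2 x)) (pY * Y).
Proof.
have -> : pY * Y = (d * (Y + Y) + c - l0 * b) * Y by rewrite /pY; ring.
have e1 := exponent_cvg l1c t1c; have e2 := exponent_cvg l2c t2c.
apply: ccvgM; last exact: cexp_quot_cvg.
apply: ccvgB; last by apply: ccvgM => //; exact: ccvg_cst.
apply: ccvgD; last exact: ccvg_cst.
by apply: ccvgM; [exact: ccvg_cst|apply: ccvgD; exact: ccvg_cexp].
Qed.

Lemma charfun_incr_lam_cvg :
  ccvg H (fun x => charfun_incr_lam (l1 x) (t1 x) (l2 x) (t2 x))
    (plam - t0%:C * (Y * pY)).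
Proof.
have -> : plam - t0%:C * (Y * pY) =
    pY * Y * - t0%:C + (l0 + l0 - (\tr A)%:C - b * Y) by rewrite /plam; ring.
apply: ccvgD.
  by apply: ccvgM => //; apply: ccvgN; exact: ccvg_real.
apply: ccvgB.
  by apply: ccvgB; [exact: ccvgD|exact: ccvg_cst].
apply: ccvgM; first exact: ccvg_cst.
by apply: ccvg_cexp; exact: exponent_cvg.
Qed.

Lemma charfun_incr_tau_cvg :
  ccvg H (fun x => charfun_incr_tau (l1 x) (t1 x) (l2 x) (t2 x)) (- (l0 * (Y * pY))).
Proof.
have -> : - (l0 * (Y * pY)) = pY * Y * - l0 by ring.
by apply: ccvgM => //; exact: ccvgN.
Qed.

End Limits.
End CharacteristicFunction.

(** * Moduli of the two branches *)

Section RealDerivatives.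
Variable R : realType.
Implicit Types (f g : R -> R) (x a : R).

(** Multiplied by [a], the quotient tends to a^2 > 0, which treats both signs of the derivative at
    once. *)
Lemma is_derive_neq0_sign f x a : is_derive x 1 f a -> a != 0 ->
  exists2 e : R, 0 < e &
    forall h, 0 < `|h| < e -> 0 < a * ((f (x + h) - f x) / h).
Proof.
move=> /is_derive1_quotP h a0.
have aa : 0 < a * a by rewrite -expr2 exprn_even_gt0.
have [e /= e0 he] := cvgr_gt _ (cvgM (cvg_cst a) h) _ aa.
exists e => // k /andP[k0 ke]; have := he (x + k).
rewrite /= opprD addNKr normrN => /(_ ke).
rewrite -subr_eq0 addrAC subrr add0r -normr_gt0; exact.
Qed.

Lemma is_derive_min_eq0 f x a :
  is_derive x 1 f a -> (forall z, f x <= f z) -> a = 0.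
Proof.
move=> fa fmin; apply/eqP; apply: contraT => a0.
have [e e0 he] := is_derive_neq0_sign fa a0.
have e2 : 0 < e / 2 by rewrite divr_gt0.
have ee : e / 2 < e by rewrite ltr_pdivrMr // ltr_pMr // ltr1n.
have h1 := he (e / 2); rewrite gtr0_norm // e2 ee in h1; have {}h1 := h1 isT.
have h2 := he (- (e / 2)); rewrite normrN gtr0_norm // e2 ee in h2; have {}h2 := h2 isT.
rewrite mulrA pmulr_lgt0 ?invr_gt0 // in h1.
rewrite invrN mulrN mulrN oppr_gt0 mulrA pmulr_llt0 ?invr_gt0 // in h2.
have k1 := fmin (x + e / 2); have k2 := fmin (x - e / 2).
rewrite -subr_ge0 in k1; rewrite -subr_ge0 in k2.
have ap : 0 < a.
  by rewrite ltNge; apply/negP => ale; move: h1; rewrite ltNge mulr_le0_ge0.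
by move: h2; rewrite pmulr_rlt0 // ltNge k2.
Qed.

Lemma nonzero_sign_const g x y : x <= y ->
  (forall z, x <= z <= y -> {for z, continuous g} /\ g z != 0) ->
  (0 < g x) = (0 < g y).
Proof.
move=> xy h.
have gc : {within `[x, y], continuous g}.
  apply: continuous_in_subspaceT => z; rewrite inE /= in_itv /= => zxy.
  by have [] := h _ zxy.
have nz z : z \in `[x, y] -> g z != 0 by rewrite in_itv /= => /h[].
have gx := nz x; have gy := nz y; rewrite !in_itv /= !lexx !xy in gx gy.
apply/idP/idP => h0; rewrite ltNge; apply/negP => h1.
  have [|z zxy gz0] := IVT (v := 0) xy gc.
    by rewrite ge_min le_max h1 (ltW h0) orbT.
  by have := nz _ zxy; rewrite gz0 eqxx.
have [|z zxy gz0] := IVT (v := 0) xy gc.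
  by rewrite ge_min le_max h1 (ltW h0) !orbT.
by have := nz _ zxy; rewrite gz0 eqxx.
Qed.

End RealDerivatives.

Section Moduli.
Variable R : realType.
Variables A B : 'M[R]_2.
Hypothesis hB : \det B != 0.
Notation d := (\det B).
Notation c := (Defs.coefC A B).
Notation b := (\tr B).
Notation F := (modulus_factor A B).
Notation f := (modulus_eq A B).
Notation z := (zdisc A B).

Definition sqrt_re (w : R) : R := Re (sqrtc (z w)).
Definition sqrt_im (w : R) : R := Im (sqrtc (z w)).
Definition modulus_sum (w : R) : R := F false w + F true w.
(* |Y_+ Y_-|^2, from the constant coefficient of the generating polynomial. *)
Definition const_modulus (w : R) : R := ((\det A - w ^+ 2) ^+ 2 + (w * \tr A) ^+ 2) / d ^+ 2.

Lemma sqrt_re_ge0 w : 0 <= sqrt_re w.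
Proof. by rewrite /sqrt_re /sqrtc; case: (z w) => x y /=; exact: sqrtr_ge0. Qed.

Lemma sqrt_reE w : sqrt_re w = Num.sqrt ((normc (z w) + Re (z w)) / 2).
Proof. by []. Qed.

Lemma sqrt_re_im w : sqrt_re w ^+ 2 - sqrt_im w ^+ 2 = Re (z w) /\
  2 * (sqrt_re w * sqrt_im w) = Im (z w).
Proof.
have := sqr_sqrtc (z w); rewrite /sqrt_re /sqrt_im; case: (sqrtc _) => x y.
move=> /complex_eqP [<- <-]; rewrite !expr2 /=; split=> //; ring.
Qed.

Lemma sqrt_re_im_norm w : sqrt_re w ^+ 2 + sqrt_im w ^+ 2 = normc (z w).
Proof.
by rewrite /sqrt_re /sqrt_im -normc_sqr -{2}(sqr_sqrtc (z w)) !expr2 ComplexField.Normc.normcM.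
Qed.

Lemma normc_Ybr s w : normc (Ybr A B s w) ^+ 2 = F s w + 1.
Proof.
rewrite /Ybr ComplexField.Normc.normcM ComplexField.Normc.normcV normc_real.
rewrite exprMn normc_sqr /modulus_factor subrK exprVn real_normK ?num_real //=.
by rewrite exprMn -natrX.
Qed.

(** Parallelogram law: the cross terms of the two branches cancel and |sqrt z|^2 = |z|, so the
    principal root and its cut disappear. *)
Lemma modulus_sumE w :
  modulus_sum w = (c ^+ 2 + (w * b) ^+ 2 + normc (z w)) / (2 * d ^+ 2) - 2.
Proof.
rewrite -sqrt_re_im_norm /modulus_sum /modulus_factor /Kbr /Hbr -/(sqrt_re w) -/(sqrt_im w).
by rewrite expr0 expr1; field.
Qed.

Lemma modulus_eqE w : f w = const_modulus w - 1 - modulus_sum w.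
Proof.
have e1 : normc (genpoly A B w 0) ^+ 2 = d ^+ 2 * (F false w + 1) * (F true w + 1).
  rewrite genpolyE // !sub0r !ComplexField.Normc.normcM !normc_opp !exprMn !normc_Ybr.
  by rewrite normc_real real_normK ?num_real.
have e2 : normc (genpoly A B w 0) ^+ 2 = (\det A - w ^+ 2) ^+ 2 + (w * \tr A) ^+ 2.
  rewrite /genpoly chardetE normc_sqr !expr2 !mulr0 !add0r.
  by simpc => /=; ring.
rewrite /modulus_eq /modulus_sum /const_modulus -e2 e1.
by field.
Qed.

Lemma modulus_sum_even w : modulus_sum (- w) = modulus_sum w.
Proof.
rewrite !modulus_sumE mulNr sqrrN.
have -> // : normc (z (- w)) = normc (z w).
by rewrite /zdisc /= mulNr !sqrrN.
Qed.

Lemma modulus_eq_even w : f (- w) = f w.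
Proof. by rewrite !modulus_eqE modulus_sum_even /const_modulus mulNr !sqrrN. Qed.

Definition const_modulus_poly : {poly R} :=
  (((\det A)%:P - 'X ^+ 2) ^+ 2 + ('X * (\tr A)%:P) ^+ 2) * (d ^- 2)%:P.

Lemma const_modulus_polyE : const_modulus = horner const_modulus_poly.
Proof. by apply/funext => w; rewrite /const_modulus /const_modulus_poly !hornerE. Qed.

Lemma is_derive_const_modulus (w : R) :
  is_derive w 1 const_modulus (const_modulus_poly^`()%R).[w].
Proof. by rewrite const_modulus_polyE; exact: is_derive_poly. Qed.

Lemma zdisc_cvg w : ccvg (nbhs w) z (z w).
Proof.
have sq : (v ^+ 2) @[v --> w] --> w ^+ 2 by exact: exprn_continuous.
apply: ccvg_complex.
  by apply: cvgD; last exact: cvg_cst; apply: cvgM => //; exact: cvg_cst.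
by apply: cvgM; [exact: cvg_id|exact: cvg_cst].
Qed.

Lemma continuous_modulus_sum : continuous modulus_sum.
Proof.
move=> w; rewrite /continuous_at (funext modulus_sumE).
apply: cvgB; last exact: cvg_cst.
apply: cvgM; last exact: cvg_cst.
apply: cvgD; last by apply: cvg_normc; exact: zdisc_cvg.
apply: cvgD; first exact: cvg_cst.
by apply: cvgM; apply: cvgM; (exact: cvg_id || exact: cvg_cst).
Qed.

Lemma continuous_modulus_eq : continuous f.
Proof.
move=> w; rewrite /continuous_at (funext modulus_eqE).
apply: cvgB; last exact: continuous_modulus_sum.
apply: cvgB; last exact: cvg_cst.
by rewrite const_modulus_polyE; exact: continuous_horner.
Qed.

Lemma simple_root_single s w : simple_root f w -> F s w = 0 -> F (~~ s) w != 0.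
Proof.
move=> [fw0 [a fa a0]] Fs; apply/eqP => Fs'.
have sw0 : modulus_sum w = 0 by rewrite /modulus_sum; case: s Fs Fs' => -> ->; rewrite addr0.
have sE : modulus_sum = (const_modulus - cst 1) - f.
  by apply/funext => v; rewrite !fctE modulus_eqE; ring.
have [e se] : exists e, is_derive w 1 modulus_sum e.
  by rewrite sE; eexists; apply: is_deriveB; apply: is_deriveB; exact: is_derive_const_modulus.
pose g := modulus_sum * modulus_sum - (cst 4 * f : R -> R).
have gE v : g v = (F false v - F true v) ^+ 2.
  by rewrite /g !fctE /modulus_sum /modulus_eq; ring.
have gw0 : g w = 0 by rewrite gE; case: s Fs Fs' => -> ->; rewrite subrr expr0n.
(* The square contributes 2 S S' = 0 because S vanishes at [w]; only - 4 f' is left. *)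
have gd : is_derive w 1 g (- (4 * a)).
  have h := is_deriveB (is_deriveM se se) (is_deriveM (is_derive_cst (4 : R) w 1) fa).
  apply: is_derive_eq h _.
  by rewrite sw0 fw0 /= !scale0r addr0 addr0 sub0r.
have := is_derive_min_eq0 gd.
have g_ge0 v : g w <= g v by rewrite gw0 gE sqr_ge0.
move=> /(_ g_ge0) /eqP.
by rewrite oppr_eq0 mulf_eq0 pnatr_eq0 /= (negbTE a0).
Qed.

Lemma modulus_factor_eq0 w : normc (z w) = 0 -> F false w = F true w.
Proof.
rewrite -sqrt_re_im_norm => /eqP; rewrite paddr_eq0 ?sqr_ge0 // !sqrf_eq0 => /andP[/eqP x0 /eqP y0].
by rewrite /modulus_factor /Kbr /Hbr -/(sqrt_re w) -/(sqrt_im w) x0 y0 !mulr0.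
Qed.

(** A vanishing real part of the principal root means that z(w) lies on the closed cut, the
    nonpositive real axis. Off it the branches are continuous and their moduli even. *)
Lemma sqrt_re_eq0 w : sqrt_re w = 0 -> w * coef_kappa A B = 0 /\ coef_mu B * w ^+ 2 + coef_eta A B <= 0.
Proof.
move=> x0; have [h1 h2] := sqrt_re_im w; move: h1 h2.
rewrite x0 mul0r mulr0 expr0n /= sub0r => <- <-; split=> //.
by rewrite oppr_le0 sqr_ge0.
Qed.

(** At w = 0 the trace term of H drops out, so with a purely imaginary root the two numerators are
    complex conjugates. *)
Lemma modulus_factor_0 : sqrt_re 0 = 0 -> F false 0 = F true 0.
Proof.
move=> x0; rewrite /modulus_factor /Kbr /Hbr -/(sqrt_re 0) -/(sqrt_im 0) x0.
by rewrite !mulr0 mul0r !add0r expr0 expr1 mul1r mulN1r sqrrN.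
Qed.

Lemma continuous_sqrt_re : continuous sqrt_re.
Proof.
move=> w; rewrite /continuous_at (funext sqrt_reE).
have [h1 _] := zdisc_cvg w.
apply: (@continuous_cvg _ _ _ _ _ (fun t => (normc (z t) + Re (z t)) / 2)
          (@Num.sqrt R) _); first exact: sqrt_continuous.
apply: cvgM; last exact: cvg_cst.
by apply: cvgD; [apply: cvg_normc; exact: zdisc_cvg|exact: h1].
Qed.

(** Dividing by the real part removes the sign convention of the principal root; continuity and
    oddness off the cut can be read off this form. *)
Lemma sqrt_imE w : sqrt_re w != 0 -> sqrt_im w = Im (z w) / (2 * sqrt_re w).
Proof. by move=> x0; have [_ <-] := sqrt_re_im w; field. Qed.

Lemma sqrt_re_even w : sqrt_re (- w) = sqrt_re w.
Proof. by rewrite !sqrt_reE /zdisc /= mulNr !sqrrN. Qed.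

Lemma sqrt_im_odd w : sqrt_re w != 0 -> sqrt_im (- w) = - sqrt_im w.
Proof.
move=> x0; rewrite !sqrt_imE ?sqrt_re_even // /zdisc /=; by rewrite !mulNr.
Qed.

Lemma sqrt_im_cvg w : sqrt_re w != 0 -> sqrt_im v @[v --> w] --> sqrt_im w.
Proof.
move=> x0; rewrite sqrt_imE //.
have [_ h2] := zdisc_cvg w.
have x2 : (2 * sqrt_re v) @[v --> w] --> 2 * sqrt_re w.
  by apply: cvgM; [exact: cvg_cst|exact: continuous_sqrt_re].
have : Im (z v) / (2 * sqrt_re v) @[v --> w] --> Im (z w) / (2 * sqrt_re w).
  by apply: cvgM => //; apply: cvgV => //; rewrite mulf_neq0.
apply: cvg_trans; apply: near_eq_cvg.
have : \forall v \near w, 0 < sqrt_re v.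
  have x0' : 0 < sqrt_re w by rewrite lt_def x0 sqrt_re_ge0.
  exact: (cvgr_gt _ (@continuous_sqrt_re w) _ x0').
by apply: filterS => v v0; rewrite -sqrt_imE // gt_eqF.
Qed.

Lemma Ybr_cvg s w : sqrt_re w != 0 -> ccvg (nbhs w) (Ybr A B s) (Ybr A B s w).
Proof.
move=> x0; apply: ccvgM; last exact: ccvg_cst.
apply: ccvg_complex.
  apply: cvgD; first exact: cvg_cst.
  by apply: cvgM; [exact: cvg_cst|exact: continuous_sqrt_re].
apply: cvgD; first by apply: cvgM; [exact: cvg_id|exact: cvg_cst].
by apply: cvgM; [exact: cvg_cst|exact: sqrt_im_cvg].
Qed.

Lemma modulus_factor_cvg s w : sqrt_re w != 0 -> {for w, continuous (F s)}.
Proof.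
move=> x0; have FE v : F s v = normc (Ybr A B s v) ^+ 2 - 1.
  by rewrite normc_Ybr addrK.
rewrite /prop_for /continuous_at (funext FE).
apply: cvgB; last exact: cvg_cst.
by apply: cvgM; apply: cvg_normc; exact: Ybr_cvg.
Qed.

Lemma modulus_factor_even s w : sqrt_re w != 0 -> F s (- w) = F s w.
Proof.
move=> x0; rewrite /modulus_factor /Kbr /Hbr -!/(sqrt_re _) -!/(sqrt_im _).
by rewrite sqrt_re_even sqrt_im_odd // mulNr mulrN -opprD sqrrN.
Qed.

End Moduli.

(** * Sign pattern forced by a single pair of simple roots *)

Section SimplePair.
Variable R : realType.
Variables A B : 'M[R]_2.
Hypothesis hB : \det B != 0.
Notation d := (\det B).
Notation c := (Defs.coefC A B).
Notation b := (\tr B).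
Notation F := (modulus_factor A B).
Notation f := (modulus_eq A B).
Notation S := (modulus_sum A B).

(** |Y_+ Y_-|^2 grows like w^4 and S at most like w^2, whence f > 0. For S > 0, the numerator of S +
    2 is at least 4 |det B| w^2 - |eta|, which tends to infinity. *)
Lemma modulus_pos_large (M : R) : exists2 w : R, M < w & 0 < f w /\ 0 < S w.
Proof.
pose mu := coef_mu B; pose eta := coef_eta A B; pose ka := coef_kappa A B.
pose N := c ^+ 2 + b ^+ 2 + `|mu| + `|eta| + `|ka|.
pose a := \det A.
have d2 : 0 < d ^+ 2 by rewrite exprn_even_gt0.
have nd : 0 < `|d| by rewrite normr_gt0.
pose P := (`|eta| + 4 * d ^+ 2) / (4 * `|d|).
have P0 : 0 <= P.
  by apply: divr_ge0; [apply: addr_ge0 => //; rewrite mulr_ge0 // ltW|rewrite mulr_ge0].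
have N0 : 0 <= N by rewrite !addr_ge0 ?sqr_ge0.
(* Beyond [P], 4 |d| W exceeds |eta| + 4 d^2; [N] bounds the numerator of S + 2 by W N; and W >= 2
   |a| + N / 2 gives (W - a)^2 >= W N / 2. The summand 1 ensures w <= w^2, so bounds on w pass to
   W. *)
pose w := 1 + `|M| + 2 * `|a| + N + P.
have Ma := ler_norm M; have a0 := normr_ge0 a; have M0 := normr_ge0 M.
have w1 : 1 <= w by rewrite /w; lra.
have wW : w <= w ^+ 2 by rewrite expr2 ler_peMr // (le_trans ler01).
have w0 : 0 <= w by apply: (le_trans _ w1).
exists w; first by rewrite /w; lra.
have Wlow : `|eta| + 4 * d ^+ 2 < 4 * `|d| * w ^+ 2.
  rewrite -ltr_pdivrMl ?mulr_gt0 // mulrC -/P; apply: (lt_le_trans _ wW).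
  by rewrite /w; lra.
have Whigh : 2 * `|a| + N / 2 <= w ^+ 2 by apply: (le_trans _ wW); rewrite /w; lra.
set W := w ^+ 2 in wW Wlow Whigh *.
have W1 : 1 <= W by apply: (le_trans _ wW).
(* |z| is bounded below by Re z or by - Re z according to the sign of d: the term in b^2 then
   cancels in the first case and has a favourable sign in the second. *)
have z_ge : 4 * `|d| * W - `|eta| <= W * b ^+ 2 + normc (zdisc A B w).
  have k := le_trans (ler_norm _) (ler_Re_normc (zdisc A B w)).
  have k' : - Re (zdisc A B w) <= normc (zdisc A B w).
    by apply: le_trans (ler_Re_normc _); rewrite -normrN ler_norm.
  have ReE : Re (zdisc A B w) = (4 * d - b ^+ 2) * W + eta by [].
  rewrite ReE in k k'.
  have e1 := ler_norm eta; have e2 : - eta <= `|eta| by rewrite -normrN ler_norm.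
  have Wb : 0 <= W * b ^+ 2 by rewrite mulr_ge0 ?sqr_ge0.
  have [d0|d0] := lerP 0 d; [rewrite ger0_norm //|rewrite ltr0_norm //];
    by move: k k'; rewrite mulrBl; lra.
have z_le : normc (zdisc A B w) <= W * (`|mu| + `|eta| + `|ka|).
  apply: le_trans (normc_le_ReIm _) _.
  have -> : Re (zdisc A B w) = mu * W + eta by [].
  have -> : Im (zdisc A B w) = w * ka by [].
  have k1 : `|mu * W + eta| <= `|mu| * W + `|eta|.
    by apply: le_trans (ler_normD _ _) _; rewrite normrM (ger0_norm (sqr_ge0 w)).
  have k2 : `|w * ka| <= W * `|ka| by rewrite normrM (ger0_norm w0) ler_wpM2r.
  have k3 : `|eta| <= W * `|eta| by rewrite ler_peMl.
  move: k1 k2 k3; rewrite !mulrDr; lra.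
have SE : S w = (c ^+ 2 + W * b ^+ 2 + normc (zdisc A B w)) / (2 * d ^+ 2) - 2.
  by rewrite modulus_sumE // exprMn.
have dd : 0 < 2 * d ^+ 2 by rewrite mulr_gt0.
have c0 := sqr_ge0 c.
split; last first.
  by rewrite SE subr_gt0 ltr_pdivlMr //; move: z_ge Wlow c0; lra.
have S_le : S w <= W * N / (2 * d ^+ 2) - 2.
  rewrite SE lerB // ler_pM2r ?invr_gt0 //.
  have k : c ^+ 2 <= W * c ^+ 2 by rewrite ler_peMl.
  by move: z_le k; rewrite /N !mulrDr; lra.
have q_ge : (W - a) ^+ 2 / d ^+ 2 <= const_modulus A B w.
  rewrite /const_modulus ler_pM2r ?invr_gt0 //.
  have -> : (W - a) ^+ 2 = (a - W) ^+ 2 by rewrite -opprB sqrrN.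
  by rewrite lerDl sqr_ge0.
rewrite modulus_eqE //.
have key : W * N / (2 * d ^+ 2) <= (W - a) ^+ 2 / d ^+ 2.
  rewrite invfM mulrA ler_pM2r ?invr_gt0 //.
  have e : a <= `|a| := ler_norm a.
  have k1 : W * (2 * `|a| + N / 2) <= W * W by rewrite ler_wpM2l // (le_trans ler01).
  have k2 : W * a <= W * `|a| by rewrite ler_wpM2l // (le_trans ler01).
  have -> : (W - a) ^+ 2 = W * W - 2 * (W * a) + a ^+ 2 by ring.
  have -> : W * N / 2 = W * (2 * `|a| + N / 2) - 2 * (W * `|a|) by ring.
  by have := sqr_ge0 a; move: k1 k2; lra.
by move: S_le q_ge key; lra.
Qed.

Section Pair.
Variable wH : R.
Hypothesis hs : only_simple_pair f wH.

Let wH0 : 0 < wH. Proof. by case: hs. Qed.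
Let sr : simple_root f wH. Proof. by case: hs. Qed.
Let srN : simple_root f (- wH). Proof. by case: hs. Qed.
Let f_neq0 w : `|w| != wH -> f w != 0.
Proof.
case: hs => _ _ _ h; apply: contraNneq => /h [->|->]; rewrite ?normrN gtr0_norm //.
Qed.
Let f_cont w : {for w, continuous f}. Proof. exact: continuous_modulus_eq. Qed.

Let f_pos_right w : wH < w -> 0 < f w.
Proof.
move=> ww; have [v vw [fv _]] := modulus_pos_large w.
rewrite (nonzero_sign_const (ltW vw)) // => x /andP[wx xv]; split=> //.
by apply: f_neq0; rewrite gt_eqF // (lt_le_trans (lt_le_trans ww wx)) ?ler_norm.
Qed.

Lemma modulus_eq_pos_out w : wH < `|w| -> 0 < f w.
Proof.
case: (lerP 0 w) => [w0|w0] h; first by rewrite f_pos_right // -(ger0_norm w0).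
by rewrite -modulus_eq_even // f_pos_right // -(ltr0_norm w0).
Qed.

(** f vanishes at [wH] and is positive to its right, so its nonzero derivative is positive. This
    sign is what makes the crossings destabilizing. *)
Lemma modulus_eq_derive_gt0 a : is_derive wH 1 f a -> 0 < a.
Proof.
move=> fa; have [f0 [a' fa' a'0]] := sr.
have aa : a = a' by have [_ <-] := fa; have [_ <-] := fa'.
rewrite -aa in a'0.
have [e e0 he] := is_derive_neq0_sign fa a'0.
have e2 : 0 < e / 2 by rewrite divr_gt0.
have := he (e / 2); rewrite gtr0_norm // e2 f0 subr0 ltr_pdivrMr // ltr_pMr // ltr1n.
move=> /(_ isT); rewrite pmulr_lgt0 // divr_gt0 // f_pos_right //.
by rewrite ltrDl.
Qed.

Lemma modulus_eq_neg_in w : `|w| < wH -> f w < 0.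
Proof.
move=> wl.
have [f0 [a fa a0]] := sr; have ap := modulus_eq_derive_gt0 fa.
have [e e0 he] := is_derive_neq0_sign fa a0.
pose h := Num.min (e / 2) ((wH - `|w|) / 2).
have h0 : 0 < h by rewrite lt_min !divr_gt0 // subr_gt0.
have he2 : h < e.
  by rewrite gt_min ltr_pdivrMr // ltr_pMr // ltr1n.
have hw : h <= (wH - `|w|) / 2 by rewrite ge_min lexx orbT.
have := he (- h); rewrite normrN gtr0_norm // h0 he2 f0 subr0 => /(_ isT).
rewrite pmulr_rgt0 // invrN mulrN oppr_gt0 pmulr_llt0 ?invr_gt0 // => fneg.
have wl' := ler_norm w.
have wv : w <= wH - h by move: hw wl wl'; lra.
have nz : forall x, w <= x <= wH - h -> {for x, continuous f} /\ f x != 0.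
  move=> x /andP[wx xv]; split=> //; apply: f_neq0; rewrite lt_eqF // ltr_norml.
  by have := ler_norm (- w); rewrite normrN; move: wl wx xv h0; lra.
have : ~~ (0 < f w) by rewrite (nonzero_sign_const wv nz) -leNgt; exact: ltW.
rewrite -leNgt le_eqVlt => /orP[|//].
by move=> /eqP fw; have := f_neq0 (negbT (lt_eqF wl)); rewrite fw eqxx.
Qed.

(** Equal factors would make f a square, against f < 0 inside; at the endpoints both would vanish,
    against simplicity. *)
Let not_eq_in w : `|w| <= wH -> F false w != F true w.
Proof.
move=> wl; apply/eqP => e; have := sqr_ge0 (F false w).
have fE : f w = F false w ^+ 2 by rewrite /modulus_eq -e expr2.
rewrite -fE leNgt => /negP; apply; move: wl; rewrite le_eqVlt => /orP[/eqP wl|]; last first.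
  exact: modulus_eq_neg_in.
have srw : simple_root f w.
  by have [w0|w0] := lerP 0 w; [rewrite -(ger0_norm w0) wl|rewrite -(opprK w) -(ltr0_norm w0) wl].
have fw0 := srw.1; rewrite fE in fw0; move/eqP: fw0; rewrite sqrf_eq0 => /eqP Fw0.
by have := simple_root_single hB srw Fw0; rewrite /= -e Fw0 eqxx.
Qed.

(** A point on the cut at 0 makes the factors equal there. A point w != 0 on the cut forces kappa =
    0, so z is real throughout; as 0 is off the cut, eta > 0, hence mu < 0, and z has a zero [v]
    with |v| <= |w|, where the two branches coincide. Both cases contradict [not_eq_in]. *)
Lemma sqrt_re_neq0 w : `|w| <= wH -> sqrt_re A B w != 0.
Proof.
move=> wl; apply/eqP => x0.
have [k1 k2] := sqrt_re_eq0 x0.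
have [w0|w0] := eqVneq w 0.
  by rewrite w0 in x0 wl; have := not_eq_in wl; rewrite (modulus_factor_0 x0) eqxx.
have eta_gt0 : 0 < coef_eta A B.
  rewrite ltNge; apply/negP => eta0.
  have n0 : `|0 : R| <= wH by rewrite normr0 ltW.
  have := not_eq_in n0; rewrite modulus_factor_0 ?eqxx // sqrt_reE.
  apply/eqP; rewrite sqrtr_eq0 /zdisc /= expr0n mulr0 add0r mul0r expr0n addr0 sqrtr_sqr.
  by rewrite ler0_norm // addNr mul0r.
have ka0 : coef_kappa A B = 0.
  by move/eqP: k1; rewrite mulf_eq0 (negbTE w0) /= => /eqP.
have w2 : 0 < w ^+ 2 by rewrite exprn_even_gt0.
have mu_lt0 : coef_mu B < 0.
  by rewrite -(pmulr_llt0 _ w2); move: k2 eta_gt0; lra.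
pose v := Num.sqrt (coef_eta A B / - coef_mu B).
have v2 : v ^+ 2 = coef_eta A B / - coef_mu B.
  by rewrite sqr_sqrtr //; apply: divr_ge0; rewrite ?oppr_ge0; exact: ltW.
have vw : `|v| <= `|w|.
  rewrite -(ler_pXn2r (n := 2)) ?nnegrE // !real_normK ?num_real // v2.
  by rewrite ler_pdivrMr ?oppr_gt0 // mulrN; move: k2; lra.
have := not_eq_in (le_trans vw wl); rewrite modulus_factor_eq0 ?eqxx //.
apply/eqP; rewrite normc_eq0; apply/eqP/complex_eqP.
rewrite /zdisc /= ka0 mulr0 v2; split=> //.
by rewrite invrN mulrN mulrN mulrCA divff ?lt_eqF // mulr1 addNr.
Qed.

(** Where S = 0, f = - F_+^2 <= 0. So S has no zero outside, and keeps the sign it has at large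
    frequencies. *)
Lemma modulus_sum_pos_out w : wH < `|w| -> 0 < S w.
Proof.
have S0 x : wH < `|x| -> S x != 0.
  move=> /modulus_eq_pos_out; rewrite /modulus_eq /modulus_sum => h; apply/eqP => e.
  have e' : F true x = - F false x by apply/eqP; rewrite -addr_eq0 addrC e.
  by move: h; rewrite e' mulrN oppr_gt0 -expr2 ltNge sqr_ge0.
have Sp x : wH < x -> 0 < S x.
  move=> wx; have [v xv [_ Sv]] := modulus_pos_large x.
  rewrite (nonzero_sign_const (ltW xv)) // => y /andP[xy yv].
  split; first exact: continuous_modulus_sum.
  by apply: S0; rewrite (lt_le_trans (lt_le_trans wx xy)) ?ler_norm.
case: (lerP 0 w) => [w0|w0] h; first by rewrite Sp // -(ger0_norm w0).
by rewrite -modulus_sum_even // Sp // -(ltr0_norm w0).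
Qed.

(** Two reals with positive sum and product are positive. The argument is pointwise, so branch cuts
    outside the interval are harmless. *)
Lemma modulus_factor_pos_out s w : wH < `|w| -> 0 < F s w.
Proof.
move=> h; have := modulus_eq_pos_out h; have := modulus_sum_pos_out h.
rewrite /modulus_eq /modulus_sum; have [f0|f0|f0] := ltgtP (F false w) 0; last by rewrite f0 mul0r ltxx.
  by rewrite nmulr_rgt0 // => k k'; move: f0 k k'; lra.
by rewrite pmulr_rgt0 // => k k'; case: s.
Qed.

Lemma inner_branch_exists : exists j : bool,
  [/\ forall w, `|w| < wH -> F j w < 0,
      forall w, `|w| = wH -> F j w = 0 &
      forall w, `|w| <= wH -> 0 < F (~~ j) w].
Proof.
have zero_in : `|0 : R| < wH by rewrite normr0.
(* The product f(0) is negative, so one factor is negative at 0; this one will be the inner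
   branch. *)
have [j Fj0] : exists j, F j 0 < 0.
  have := modulus_eq_neg_in zero_in; rewrite /modulus_eq => h.
  have [f0|f0] := ltP (F false 0) 0; first by exists false.
  by exists true; rewrite ltNge; apply/negP => f1; move: h; rewrite ltNge mulr_ge0.
have prodE w : f w = F j w * F (~~ j) w by rewrite /modulus_eq; case: (j); rewrite //= mulrC.
have sumE w : S w = F j w + F (~~ j) w by rewrite /modulus_sum; case: (j); rewrite //= addrC.
have F_neq0 s w : `|w| < wH -> F s w != 0.
  move=> wl; apply: contraTneq (modulus_eq_neg_in wl) => e.
  by rewrite /modulus_eq; case: s e => ->; rewrite ?mulr0 ?mul0r ltxx.
have F_cont s w : `|w| <= wH -> {for w, continuous (F s)}.
  by move=> wl; apply: modulus_factor_cvg => //; exact: sqrt_re_neq0.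
have neg_in x : `|x| < wH -> F j x < 0.
  wlog x0 : x / 0 <= x.
    move=> hw xl; have [/hw|x0] := lerP 0 x; first exact.
    rewrite -modulus_factor_even; last by rewrite sqrt_re_neq0 // ltW.
    by apply: hw; rewrite ?normrN // oppr_ge0 ltW.
  move=> xl.
  have nz y : 0 <= y <= x -> {for y, continuous (F j)} /\ F j y != 0.
    move=> /andP[y0 yx]; have yl : `|y| < wH.
      by rewrite ger0_norm // (le_lt_trans yx) // (le_lt_trans _ xl) ?ler_norm.
    by split; [apply: F_cont; exact: ltW|exact: F_neq0].
  have e := nonzero_sign_const x0 nz; rewrite ltNge le_eqVlt -e negb_or eq_sym F_neq0 //=.
  by rewrite -leNgt ltW.
have srw w : `|w| = wH -> simple_root f w.
  move=> wl; have [w0|w0] := lerP 0 w; first by rewrite -(ger0_norm w0) wl.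
  by rewrite -(opprK w) -(ltr0_norm w0) wl.
have F_wH : F j wH = 0 /\ 0 < F (~~ j) wH.
  have [f0 _] := sr; rewrite prodE in f0; move/eqP: f0; rewrite mulf_eq0.
  have wHn : `|wH| = wH by rewrite gtr0_norm.
  have [Fj|Fj] /= := eqVneq (F j wH) 0.
    move=> _; split=> //; have nz := simple_root_single hB sr Fj.
    (* S is positive to the right of [wH], so nonnegative at [wH] by continuity; as F_j vanishes
       there, S is the other factor. *)
    have S0 : 0 <= S wH.
      rewrite leNgt; apply/negP => Sneg.
      have Sc : {for wH, continuous S} by exact: continuous_modulus_sum.
      have [e /= e0 he] := cvgr_lt _ Sc _ Sneg.
      have e2 : 0 < e / 2 by rewrite divr_gt0.
      have := he (wH + e / 2); rewrite /= opprD addNKr normrN gtr0_norm //.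
      rewrite ltr_pdivrMr // ltr_pMr // ltr1n => /(_ isT).
      rewrite ltNge ltW //; apply: modulus_sum_pos_out.
      by rewrite gtr0_norm ?ltrDl // addr_gt0.
    by rewrite lt_def nz; move: S0; rewrite sumE Fj add0r.
  (* If F_j did not vanish at [wH], it would be negative there as a limit of negative values, hence
     still negative slightly beyond, where both factors are positive. *)
  move=> /eqP Fj'; exfalso.
  have [e /= e0 he] : \forall x \near wH, F j x < 0.
    have Fjneg : F j wH < 0.
      have Fc : {for wH, continuous (F j)} by apply: F_cont; rewrite wHn.
      rewrite lt_neqAle Fj leNgt; apply/negP => Fpos.
      have [e /= e0 he] := cvgr_gt _ Fc _ Fpos.
      pose h := Num.min (e / 2) (wH / 2).
      have h0 : 0 < h by rewrite lt_min !divr_gt0.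
      have h1 : h < e by rewrite gt_min ltr_pdivrMr // ltr_pMr // ltr1n.
      have h2 : h < wH.
        by rewrite gt_min; apply/orP; right; rewrite ltr_pdivrMr // ltr_pMr // ltr1n.
      have := he (wH - h); rewrite /= opprB addrCA subrr addr0 gtr0_norm // => /(_ h1).
      rewrite ltNge ltW //; apply: neg_in.
      by rewrite gtr0_norm ?subr_gt0 // ltrBlDr ltrDl.
    have Fc : {for wH, continuous (F j)} by apply: F_cont; rewrite wHn.
    exact: (cvgr_lt _ Fc _ Fjneg).
  have e2 : 0 < e / 2 by rewrite divr_gt0.
  have := he (wH + e / 2); rewrite /= opprD addNKr normrN gtr0_norm //.
  rewrite ltr_pdivrMr // ltr_pMr // ltr1n => /(_ isT).
  rewrite ltNge ltW //; apply: modulus_factor_pos_out.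
  by rewrite gtr0_norm ?ltrDl // addr_gt0.
have at_wH s w : `|w| = wH -> F s w = F s wH.
  move=> wl; have [w0|w0] := lerP 0 w; first by rewrite -wl ger0_norm.
  rewrite -wl ltr0_norm // modulus_factor_even //.
  by rewrite sqrt_re_neq0 // wl.
exists j; split=> // w; first by move=> /at_wH ->; case: F_wH.
rewrite le_eqVlt => /orP[/eqP/at_wH ->|wl]; first by case: F_wH.
have := modulus_eq_neg_in wl; rewrite prodE nmulr_rlt0 //.
exact: neg_in.
Qed.

End Pair.
End SimplePair.

(** As u vanishes at x, the quotient of u v is that of u times v(t): continuity of v is enough, and
    v(x) != 0 gives the converse. This carries simplicity between f and its vanishing factor. *)
Lemma is_derive_mul_root (R : realType) (g u v : R -> R) (x a b : R) :
  g = (fun t => u t * v t) -> b = a * v x ->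
  u x = 0 -> {for x, continuous v} -> v x != 0 ->
  is_derive x 1 g b <-> is_derive x 1 u a.
Proof.
move=> -> -> ux0 vc vx0.
have {}vc : v t @[t --> x^'] --> v x.
  by apply: cvg_trans vc; apply: cvg_app; exact: nbhs_dnbhs.
rewrite !is_derive1_quotP ux0 mul0r; split=> h.
  have : (u t * v t - 0) / (t - x) / v t @[t --> x^'] --> a * v x / v x.
    by apply: cvgM => //; exact: cvgV.
  rewrite mulfK //; apply: cvg_trans; apply: near_eq_cvg; near=> t.
  rewrite !subr0 [u t * v t / _]mulrAC mulfK //.
  near: t; exact: cvgr_neq0 vc _.
have : (u t - 0) / (t - x) * v t @[t --> x^'] --> a * v x by exact: cvgM.
apply: cvg_trans; apply: near_eq_cvg; near=> t.
by rewrite !subr0 mulrAC.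
Unshelve. all: by end_near. Qed.

Lemma neq_negb (s j : bool) : s != j -> s = ~~ j.
Proof. by move: s j => [] []. Qed.

(** * Class I and simple pairs of roots *)

Section Spectrum.
Variable R : realType.
Variables A B : 'M[R]_2.
Hypothesis hB : \det B != 0.
Notation F := (modulus_factor A B).
Notation f := (modulus_eq A B).
Notation gam := (Defs.gamma A B).
Notation nY s w := (normc (Ybr A B s w)).

Lemma normc_Ybr_lt1 s w : (nY s w < 1) = (F s w < 0).
Proof.
by rewrite -(ltr_pXn2r (n := 2)) ?nnegrE ?normc_ge0 // normc_Ybr expr1n -subr_gt0 opprD addrCA subrr addr0 oppr_gt0.
Qed.

Lemma normc_Ybr_eq1 s w : (nY s w == 1) = (F s w == 0).
Proof.
by rewrite -(eqrXn2 (n := 2)) ?normc_ge0 // normc_Ybr expr1n -subr_eq0 addrK.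
Qed.

Lemma gamma_gt0 s w : (0 < gam s w)%E = (F s w < 0).
Proof. by rewrite /Defs.gamma oppe_gt0 lne_lt0 lte_fin normc_Ybr_lt1. Qed.

Lemma gamma_eq0 s w : (gam s w == 0%E) = (F s w == 0).
Proof. by rewrite /Defs.gamma oppe_eq0 lne_eq0 eqe normc_Ybr_eq1. Qed.

Lemma gamma_lt0 s w : (gam s w < 0)%E = (0 < F s w).
Proof.
by rewrite ltNge le_eqVlt eq_sym gamma_eq0 gamma_gt0 negb_or -leNgt lt_def.
Qed.

Lemma fine_gammaE s : fine \o gam s = (fun w => - ln (nY s w)).
Proof.
apply/funext => w; rewrite compE /Defs.gamma.
(* Where Y vanishes both sides are 0: [fine] sends the infinite value to 0, and [ln 0] is 0. *)
have [y0|y0] := eqVneq (nY s w) 0.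
  by rewrite y0 le0_lneNy ?lexx // ln0 ?lexx // oppr0.
by rewrite lne_EFin // lt_def y0 normc_ge0.
Qed.

Lemma ln_normc_Ybr s w : - ln (nY s w) = - 2^-1 * ln (F s w + 1).
Proof.
rewrite -normc_Ybr; have [->|y0] := eqVneq (nY s w) 0.
  by rewrite expr0n ln0 // mulr0 oppr0.
rewrite lnXn ?lt_def ?y0 ?normc_ge0 // mulr2n; by field.
Qed.

Lemma modulus_eq_mulE s : f = (fun w => F s w * F (~~ s) w).
Proof. by apply/funext => w; rewrite /modulus_eq; case: s; rewrite //= mulrC. Qed.

Section Pair.
Variable wH : R.
Hypothesis hs : only_simple_pair f wH.

Let wH0 : 0 < wH. Proof. by case: hs. Qed.

Lemma simple_pair_class_I : class_I A B.
Proof.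
have [j [jin jat jout]] := inner_branch_exists hB hs.
have wHn : `|wH| = wH by rewrite gtr0_norm.
exists wH => //; exists j; split.
- by apply/eqP; rewrite gamma_eq0 jat.
- by apply/eqP; rewrite gamma_eq0 jat // normrN.
- by move=> w wl; rewrite gamma_gt0 jin // ltr_norml.
- move=> w wl; rewrite gamma_lt0 (modulus_factor_pos_out hB hs) // lter_normr.
  by rewrite ltrNr orbC.
move=> k w kj /eqP; rewrite gamma_eq0; apply/negP.
rewrite (neq_negb kj).
have [wl|wl] := leP `|w| wH; first by rewrite gt_eqF // jout.
by rewrite gt_eqF // (modulus_factor_pos_out hB hs).
Qed.

(** The vanishing factor has derivative f' divided by the other factor, and gamma = - ln(F + 1) / 2
    has derivative - F' / 2 where F = 0. *)
Lemma simple_pair_transversal : ACS_transversal A B.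
Proof.
have [j [jin jat jout]] := inner_branch_exists hB hs.
move=> s w /eqP; rewrite gamma_eq0 => /eqP Fs0.
have wl : `|w| = wH.
  case: hs => _ _ _ /(_ w); rewrite (modulus_eq_mulE s) Fs0 mul0r => /(_ erefl).
  by case=> ->; rewrite ?normrN gtr0_norm.
have sj : s = j.
  have [//|/neq_negb sj] := eqVneq s j.
  by have := jout w; rewrite wl lexx -sj Fs0 ltxx => /(_ isT).
have srw : simple_root f w.
  case: hs => _ sr srN _; have [w0|w0] := lerP 0 w; first by rewrite -(ger0_norm w0) wl.
  by rewrite -(opprK w) -(ltr0_norm w0) wl.
have [_ [a fa a0]] := srw.
have Fk0 : F (~~ s) w != 0 by rewrite sj gt_eqF // jout // wl.
have Fkc : {for w, continuous (F (~~ s))}.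
  by apply: modulus_factor_cvg; apply: (sqrt_re_neq0 hB hs); rewrite wl.
have Fd : is_derive w 1 (F s) (a / F (~~ s) w).
  have e : a = a / F (~~ s) w * F (~~ s) w by apply/esym; exact: divfK.
  exact: (is_derive_mul_root (modulus_eq_mulE s) e Fs0 Fkc Fk0).1 fa.
rewrite fine_gammaE (funext (ln_normc_Ybr s)).
exists (- 2^-1 * (a / F (~~ s) w)); last first.
  by rewrite !mulf_neq0 ?oppr_eq0 ?invr_eq0 ?pnatr_eq0.
have hF : is_derive w 1 (F s + cst 1) (a / F (~~ s) w + 0).
  exact: is_deriveD.
have hl : is_derive ((F s + cst 1) w) 1 (@ln R) 1.
  rewrite !fctE Fs0 add0r; have := is_derive1_ln (ltr01 : (0 : R) < 1); by rewrite invr1.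
have := is_deriveM (is_derive_cst (- 2^-1 : R) w 1) (is_derive1_comp hl hF).
move=> h; apply: is_derive_eq h _.
by rewrite scaler0 !addr0 mul1r.
Qed.

End Pair.

Lemma class_I_simple_pair : class_I A B -> ACS_transversal A B ->
  exists wH, only_simple_pair f wH.
Proof.
move=> [wH wH0 [j [g1 g2 gin gout gk]]] tr; exists wH.
have simple w : gam j w = 0%E -> simple_root f w.
  move=> gw; have Fw : F j w = 0 by apply/eqP; rewrite -gamma_eq0 gw.
  have Fk : F (~~ j) w != 0.
    rewrite -gamma_eq0; apply/eqP/gk; by case: (j).
  split; first by rewrite (modulus_eq_mulE j) Fw mul0r.
  have [a ga a0] := tr _ _ gw; rewrite fine_gammaE in ga.
  pose g v := - ln (nY j v).
  have nYw : nY j w = 1 by apply/eqP; rewrite normc_Ybr_eq1 Fw.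
  have gw0 : g w = 0 by rewrite /g nYw ln1 oppr0.
  have [e e0 he] := is_derive_neq0_sign ga a0.
  (* The convention [ln 0 = 0] would break this identity at a zero of Y. But g would vanish at such
     a point too, while its nonzero derivative makes w an isolated zero of g. *)
  have near_e : \forall v \near w, expR (- 2 * g v) - 1 = F j v.
    exists e => // v /= wv; apply/eqP; rewrite subr_eq -normc_Ybr; apply/eqP.
    have nv : 0 < nY j v.
      rewrite lt_def normc_ge0 andbT.
      have [->|vw] := eqVneq v w; first by rewrite nYw oner_eq0.
      apply/eqP => nv0.
      have hv : 0 < a * ((g v - g w) / (v - w)).
        have := he (v - w); rewrite normr_gt0 subr_eq0 vw distrC wv.
        by rewrite [w + _]addrC subrK; apply.
      by move: hv; rewrite gw0 /g nv0 ln0 // oppr0 addr0 mul0r mulr0 ltxx.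
    by rewrite /g mulrNN mulr_natl mulr2n expRD lnK // -expr2.
  have gd : is_derive w 1 (cst (- 2) * g : R -> R) (- 2 * a).
    have := is_deriveM (is_derive_cst (- 2 : R) w 1) ga; move=> h; apply: is_derive_eq h _.
    by rewrite scaler0 addr0.
  have ed : is_derive ((cst (- 2) * g) w) 1 (@expR R) 1.
    by rewrite !fctE gw0 mulr0; have := is_derive_expR (0 : R); rewrite expR0.
  have Fd : is_derive w 1 (F j) (- 2 * a).
    have h := is_deriveB (is_derive1_comp ed gd) (is_derive_cst (1 : R) w 1).
    have {}h : is_derive w 1 (F j) (1 * (- 2 * a) - 0).
      exact: near_eq_is_derive near_e h.
    by apply: is_derive_eq h _; rewrite mul1r subr0.
  exists (- 2 * a * F (~~ j) w); last by rewrite !mulf_neq0 ?oppr_eq0 ?pnatr_eq0.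
  have Fjc : {for w, continuous (F j)}.
    by apply: differentiable_continuous; apply/derivable1_diffP; have [] := Fd.
  (* Position relative to the cut is unknown here, so continuity of the other factor is obtained
     from S - F_j. *)
  have Fkc : {for w, continuous (F (~~ j))}.
    have FE : F (~~ j) = (fun v => modulus_sum A B v - F j v).
      by apply/funext => v; rewrite /modulus_sum; case: (j) => /=; ring.
    rewrite FE; apply: cvgB => //; exact: continuous_modulus_sum.
  exact: (is_derive_mul_root (modulus_eq_mulE j) erefl Fw Fkc Fk).2 Fd.
split=> //; [exact: simple|exact: simple|].
move=> w fw.
have [s Fs] : exists s, F s w = 0.
  move/eqP: fw; rewrite /modulus_eq mulf_eq0 => /orP[/eqP h|/eqP h]; first by exists false.
  by exists true.
have gs : gam s w = 0%E by apply/eqP; rewrite gamma_eq0 Fs.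
have sj : s = j by apply/eqP; apply: contraT => /gk /(_ gs).
rewrite sj in gs.
have [wl|wl|->] := ltgtP w wH; last by left.
  have [wl'|wl'|->] := ltgtP w (- wH); last by right.
    by have := gout w; rewrite wl' gs ltxx => /(_ isT).
  by have := gin w; rewrite wl wl' gs ltxx => /(_ isT).
by have := gout w; rewrite wl orbT gs ltxx => /(_ isT).
Qed.

End Spectrum.

(** * Crossings *)

Section Arguments.
Variable R : realType.

Lemma cos_periodic_int (k : int) (x : R) : cos (x + 2 * pi * k%:~R) = cos x.
Proof.
have e (n : nat) : 2 * pi * n%:R = (pi *+ 2) *+ n :> R by rewrite mulr_natr mulr_natl.
case: k => n; first by rewrite -pmulrn e (periodicn (@cosD2pi R)).
rewrite NegzE mulrNz mulrN -pmulrn e.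
by rewrite -[in RHS](subrK ((pi *+ 2) *+ n.+1) x) (periodicn (@cosD2pi R)).
Qed.

Lemma sin_periodic_int (k : int) (x : R) : sin (x + 2 * pi * k%:~R) = sin x.
Proof.
by rewrite -!cosBpihalf addrAC cos_periodic_int.
Qed.

Lemma cos_eq1 (t : R) : cos t = 1 -> exists k : int, t = 2 * pi * k%:~R.
Proof.
move=> ct; have pi0 := pi_gt0 R; have p2 : 0 < 2 * pi :> R by rewrite mulr_gt0.
pose k := Num.floor (t / (2 * pi)); exists k; pose r := t - 2 * pi * k%:~R.
have cr : cos r = 1 by rewrite -ct /r -mulrN -mulrNz cos_periodic_int.
have r0 : 0 <= r by rewrite subr_ge0 mulrC -ler_pdivlMr // floor_le.
have r2 : r < 2 * pi.
  rewrite ltrBlDl -{2}(mulr1 (2 * pi)) -mulrDr mulrC -ltr_pdivrMr //.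
  by have := floorD1_gt (t / (2 * pi)); rewrite rmorphD.
apply/eqP; rewrite -subr_eq0 -/r; apply/eqP.
have i0 : 0 \in `[0, pi : R] by rewrite in_itv /= lexx ltW.
have [rp|rp] := lerP r pi.
  by apply: (@cos_inj R) => //; [rewrite in_itv /= r0|rewrite cos0].
have : 2 * pi - r = 0.
  apply: (@cos_inj R) => //; first by rewrite in_itv /=; apply/andP; split; lra.
  have := cos_periodic_int 1 (- r).
  by rewrite mulr1z mulr1 addrC cos0 => ->; rewrite cosN cr.
by move/eqP; rewrite subr_eq0 => /eqP e; rewrite e ltxx in r2.
Qed.

Lemma cos_sin_eq (x y : R) : cos x = cos y -> sin x = sin y ->
  exists k : int, x = y + 2 * pi * k%:~R.
Proof.
move=> hc hs; have [|k e] := @cos_eq1 (x - y).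
  by rewrite cosB hc hs -!expr2 cos2Dsin2.
by exists k; rewrite -e addrC subrK.
Qed.

Lemma carg_unit (u : R[i]) : normc u = 1 ->
  [/\ cos (carg u) = Re u, sin (carg u) = Im u & carg u <= pi].
Proof.
move=> u1; have ru : `|Re u| <= 1 by rewrite -u1 ler_Re_normc.
have ru' : -1 <= Re u <= 1 by rewrite -ler_norml.
have n2 := normc_sqr u; rewrite u1 expr1n in n2.
have s : Num.sqrt (1 - Re u ^+ 2) = `|Im u| by rewrite n2 addrAC subrr add0r sqrtr_sqr.
rewrite /carg u1 divr1; case: (lerP 0 (Im u)) => iu.
  by rewrite acosK // sin_acos // s ger0_norm // acos_lepi.
rewrite cosN sinN acosK // sin_acos // s ltr0_norm // opprK; split=> //.
by rewrite (le_trans _ (pi_ge0 R)) // oppr_le0 acos_ge0.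
Qed.

Lemma cexp_imag (t w : R) : cexp (- (t%:C * (0 +i* w))) = cos (t * w) +i* - sin (t * w).
Proof.
have -> : - (t%:C * (0 +i* w)) = 0 +i* - (t * w).
  by apply/complex_eqP; split=> /=; ring.
by rewrite /cexp /= expR0 !mul1r cosN sinN.
Qed.

End Arguments.

Lemma ccvg_conj (R : realType) (T : Type) (H : set_system T) {FH : Filter H}
    (u : T -> R[i]) (l : R[i]) :
  ccvg H u l -> ccvg H (fun t => (u t)^*%C) (l^*%C).
Proof.
move=> [h1 h2]; have eR (x : R[i]) : Re (x^*%C) = Re x by case: x.
have eI (x : R[i]) : Im (x^*%C) = - Im x by case: x.
split; first by rewrite eR; under eq_fun do rewrite eR.
by rewrite eI; under eq_fun do rewrite eI; exact: cvgN.
Qed.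

(** * Imaginary roots and the speed at which they cross *)

Section Crossings.
Variable R : realType.
Variables A B : 'M[R]_2.
Hypothesis hB : \det B != 0.
Notation d := ((\det B)%:C).
Notation c := ((Defs.coefC A B)%:C).
Notation b := ((\tr B)%:C).
Notation F := (modulus_factor A B).
Notation f := (modulus_eq A B).
Notation Y := (Ybr A B).

(** On the imaginary axis the exponential has modulus 1, and it is a root of the generating
    polynomial. *)
Lemma char_root_imag (tau w : R) : char_root A B tau (0 +i* w) ->
  exists s, cexp (- (tau%:C * (0 +i* w))) = Y s w /\ F s w = 0.
Proof.
rewrite /char_root -/(genpoly A B w _) genpolyE // => /eqP.
set E := cexp _; have nE : normc E ^+ 2 = 1.
  by rewrite /E cexp_imag normc_sqr /= sqrrN cos2Dsin2.
have d0 : d != 0 by rewrite fmorph_eq0.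
rewrite !mulf_eq0 (negbTE d0) !subr_eq0 /=.
case/orP => /eqP e; [exists false|exists true]; split=> //;
  by apply: (addIr 1); rewrite -normc_Ybr // -e nE add0r.
Qed.

Lemma Ybr_sum w : d * (Y false w + Y true w) = (0 +i* w) * b - c.
Proof.
have d0 : \det B != 0 by [].
rewrite /Ybr /Kbr /Hbr expr0 expr1; apply/complex_eqP.
by split; rewrite /=; simpc; rewrite /=; field.
Qed.

Section Pair.
Variables (wH : R) (j : bool).
Hypothesis wH0 : 0 < wH.
Hypothesis Fj0 : F j wH = 0.
Hypothesis Fk0 : F (~~ j) wH != 0.
Hypothesis xH : sqrt_re A B wH != 0.
Variable a : R.
Hypothesis a0 : 0 < a.
Hypothesis Fja : is_derive wH 1 (F j) a.

Let l0 : R[i] := 0 +i* wH.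
Let Y0 := Y j wH.
Let pY := 2 * d * Y0 + c - l0 * b.
Let plam := 2 * l0 - (\tr A)%:C - b * Y0.

Let Y0n : normc Y0 = 1.
Proof. by apply/eqP; rewrite normc_Ybr_eq1 // Fj0. Qed.

Let Y0_neq0 : Y0 != 0.
Proof. by rewrite -normc_eq0 Y0n oner_eq0. Qed.

(** By Vieta, [pY] is det B times the difference of the two roots, and only one of these has modulus
    1. *)
Let pY_neq0 : pY != 0.
Proof.
have -> : pY = d * (Y0 - Y (~~ j) wH).
  have : d * (Y0 + Y (~~ j) wH) = l0 * b - c.
    by rewrite -Ybr_sum /Y0; case: (j) => //=; rewrite [Y true _ + _]addrC.
  move=> e; have -> : pY = 2 * d * Y0 - (l0 * b - c) by rewrite /pY; ring.
  by rewrite -e; ring.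
rewrite mulf_neq0 ?fmorph_eq0 // subr_eq0; apply: contraNneq Fk0 => e.
by rewrite -normc_Ybr_eq1 // -e Y0n.
Qed.

Let q := plam / (Y0 * pY).

Let genpoly_Y s w : genpoly A B w (Y s w) = 0.
Proof. by rewrite genpolyE //; case: s; rewrite subrr ?mulr0 ?mul0r. Qed.

(** |Y|^2 has derivative 2 Re (Y' conj Y). Along the branch Y' = - i plam / pY, and conj Y0 = 1 / Y0
    on the unit circle, which leaves 2 Re (- i q). *)
Let q_im : a = 2 * Im q.
Proof.
have tc : v @[v --> wH^'] --> wH by exact: nbhs_dnbhs.
have Yc : ccvg wH^' (Y j) Y0.
  have [h1 h2] := Ybr_cvg j xH; split.
    by apply: cvg_trans h1; apply: cvg_app; exact: nbhs_dnbhs.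
  by apply: cvg_trans h2; apply: cvg_app; exact: nbhs_dnbhs.
pose de v : R[i] := 'i * (v - wH)%:C.
have dec : ccvg wH^' de 0.
  have -> : 0 = 'i * (wH - wH)%:C :> R[i] by rewrite subrr mulr0.
  apply: ccvgM; first exact: ccvg_cst.
  by apply: ccvg_real; apply: cvgB => //; exact: cvg_cst.
pose G v := pY + d * (Y j v - Y0) - b * de v.
have Gc : ccvg wH^' G pY.
  have -> : pY = pY + d * (Y0 - Y0) - b * 0 by rewrite subrr !mulr0 addr0 subr0.
  apply: ccvgB; last by apply: ccvgM => //; exact: ccvg_cst.
  apply: ccvgD; first exact: ccvg_cst.
  apply: ccvgM; first exact: ccvg_cst.
  by apply: ccvgB => //; exact: ccvg_cst.
(* The exact increment of the quadratic polynomial between two of its zeros; it yields the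
   derivative of the branch from mere continuity. *)
have incr v : (Y j v - Y0) * G v = - de v * (plam + de v).
  have e1 := genpoly_Y j v; have e2 := genpoly_Y j wH.
  rewrite /genpoly !chardetE -/l0 -/Y0 in e1 e2.
  have lE : 0 +i* v = l0 + de v.
    by rewrite /l0 /de; apply/complex_eqP; split=> /=; ring.
  rewrite lE in e1; apply/eqP; rewrite -subr_eq0 -[X in _ == X](subrr (0 : R[i])).
  rewrite -[X in _ == X - _]e1 -[X in _ == _ - X]e2; apply/eqP.
  by rewrite /G /pY /plam; ring.
pose Y' v := - 'i * (plam + de v) / G v.
have Y'c : ccvg wH^' Y' (- 'i * plam / pY).
  apply: ccvgM; last exact: ccvgV.
  apply: ccvgM; first exact: ccvg_cst.
  by rewrite -[X in ccvg _ _ X]addr0; apply: ccvgD => //; exact: ccvg_cst.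
(* The second factor in |y|^2 - |y0|^2 = Re ((y - y0) conj (y + y0)). *)
have Jc : ccvg wH^' (fun v => (Y j v + Y0)^*%C) ((Y0 + Y0)^*%C).
  by apply: ccvg_conj; apply: ccvgD => //; exact: ccvg_cst.
have [lim _] := ccvgM Y'c Jc.
have lim2 : (F j v - F j wH) / (v - wH) @[v --> wH^'] --> Re (- 'i * plam / pY * (Y0 + Y0)^*%C).
  apply: cvg_trans lim; apply: near_eq_cvg; near=> v.
  have vw : v - wH != 0 by rewrite subr_eq0; near: v; exact: nbhs_dnbhs_neq.
  have Gv : G v != 0.
    rewrite -normc_gt0; near: v; apply: (cvgr_gt _ (cvg_normc Gc)).
    by rewrite normc_gt0.
  have -> : Y' v = (Y j v - Y0) * ((v - wH)^-1)%:C.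
    apply: (mulIf Gv); rewrite divfK // mulrAC incr /de fmorphV.
    have : (v - wH)%:C != 0 by rewrite fmorph_eq0.
    by move=> vw'; field; move: vw'; rewrite rmorphB.
  have FE u : F j u = Re (Y j u) ^+ 2 + Im (Y j u) ^+ 2 - 1.
    by rewrite -normc_sqr normc_Ybr // addrK.
  rewrite !FE -/Y0; case: (Y j v) => x y; case: (Y0) => x' y' /=.
  by ring.
have -> := cvg_unique _ ((is_derive1_quotP _ _ _).1 Fja) lim2.
have Y0J : Y0^*%C = Y0^-1.
  apply: (mulfI Y0_neq0); rewrite divff //.
  have := normc_sqr Y0; rewrite Y0n expr1n; case: (Y0) => x y /= e.
  by apply/complex_eqP; split => /=; [rewrite e|]; ring.
have -> : - 'i * plam / pY * (Y0 + Y0)^*%C = - 'i * (2 * q).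
  have -> : (Y0 + Y0)^*%C = Y0^*%C + Y0^*%C by rewrite -rmorphD.
  rewrite Y0J /q; move: pY_neq0 Y0_neq0; move: (pY) (Y0) (plam) => p y l p0 y0.
  by field; rewrite p0 y0.
by rewrite mulr_natl mulr2n; case: (q) => x y /=; ring.
Unshelve. all: by end_near. Qed.

Section Delay.
Variable tau : R.
Hypothesis EY : cexp (- (tau%:C * l0)) = Y0.
Let D := plam - tau%:C * (Y0 * pY).
Let D' := - (l0 * (Y0 * pY)).

Let D_E : D = Y0 * pY * (q - tau%:C).
Proof.
rewrite /D /q; move: pY_neq0 Y0_neq0; move: (pY) (Y0) (plam) => p y l p0 y0.
by field; rewrite p0 y0.
Qed.

Let Im_q_gt0 : 0 < Im q.
Proof. by rewrite -(pmulr_rgt0 _ (ltr0Sn R 1)) -q_im. Qed.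

(** A delay is real while Im q > 0, so the root is simple whatever the delay. *)
Let qtau_neq0 : q - tau%:C != 0.
Proof.
apply/eqP => /(congr1 (@complex.Im R)) /eqP; rewrite raddfB /= subr0.
by rewrite gt_eqF.
Qed.

Let D_neq0 : D != 0. Proof. by rewrite D_E; apply: mulf_neq0 => //; exact: mulf_neq0. Qed.

Let rate_gt0 : 0 < Re (- D' / D).
Proof.
have -> : - D' / D = l0 / (q - tau%:C).
  rewrite D_E /D'; move: pY_neq0 Y0_neq0 qtau_neq0.
  move: (pY) (Y0) (q - tau%:C) => p y r p0 y0 r0.
  by field; rewrite p0 y0 r0.
have -> : Re (l0 / (q - tau%:C)) = wH * Im q / normc (q - tau%:C) ^+ 2.
  by rewrite normc_sqr /l0; case: (q) => x y /=; ring.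
apply: divr_gt0; first exact: mulr_gt0.
by apply: exprn_gt0; rewrite normc_gt0.
Qed.

Let PhiD (T : Type) (H : set_system T) : Filter H ->
  forall (l1 l2 : T -> R[i]) (t1 t2 : T -> R),
    ccvg H l1 l0 -> ccvg H l2 l0 -> t1 @ H --> tau -> t2 @ H --> tau ->
    ccvg H (fun x => charfun_incr_lam A B (l1 x) (t1 x) (l2 x) (t2 x)) D.
Proof.
move=> FH l1 l2 t1 t2 h1 h2 h3 h4.
by have := charfun_incr_lam_cvg (FH := FH) A B h1 h2 h3 h4; rewrite EY.
Qed.

Let PsiD (T : Type) (H : set_system T) : Filter H ->
  forall (l1 l2 : T -> R[i]) (t1 t2 : T -> R),
    ccvg H l1 l0 -> ccvg H l2 l0 -> t1 @ H --> tau -> t2 @ H --> tau ->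
    ccvg H (fun x => charfun_incr_tau A B (l1 x) (t1 x) (l2 x) (t2 x)) D'.
Proof.
move=> FH l1 l2 t1 t2 h1 h2 h3 h4.
by have := charfun_incr_tau_cvg (FH := FH) A B h1 h2 h3 h4; rewrite EY.
Qed.

Let charfun0 : charfun A B l0 tau = 0.
Proof. by rewrite /charfun EY; exact: genpoly_Y. Qed.

Lemma crossing_rate_gt0 (v : R) : crossing A B tau wH v -> 0 < v.
Proof.
move=> [al [be [near_ab al0 be0 dal]]].
have [ca cb _ _] := nbhs_singleton near_ab.
have h : is_derive tau 1 al (Re (- D' / D)).
  apply: (implicit_derive (charfun_incr A B) PhiD PsiD D_neq0 charfun0 ca cb).
    by rewrite al0 be0.
  by apply: filterS near_ab => t [_ _ r _]; exact: r.
by have [_ <-] := dal; have [_ ->] := h.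
Qed.

Lemma destabilizing_crossing_ex : destabilizing_crossing A B tau wH.
Proof.
have [al [be [ab0 near_ab]]] :=
  implicit_function (charfun_incr A B) PhiD PsiD D_neq0 charfun0.
have [ca cb _] := nbhs_singleton near_ab.
exists (Re (- D' / D)) => //; exists al, be; split.
- apply: filterS near_ab => t [ct dt ft].
  have r : char_root A B t (al t +i* be t) by exact: ft.
  by split; [exact: ct|exact: dt|exact: r|exact: char_root_conj r].
- by move/complex_eqP: ab0 => [].
- by move/complex_eqP: ab0 => [].
apply: (implicit_derive (charfun_incr A B) PhiD PsiD D_neq0 charfun0 ca cb ab0).
by apply: filterS near_ab => t [].
Qed.

End Delay.
End Pair.

Section SimplePair.
Variable wH : R.
Hypothesis hs : only_simple_pair f wH.

Let wH0 : 0 < wH. Proof. by case: hs. Qed.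

Let wHn : `|wH| = wH. Proof. by rewrite gtr0_norm. Qed.

(** The case distinction of [phiH]. Only one factor vanishes at [wH], so the selected one is the
    inner branch. *)
Let crossing_branch : bool := F false wH != 0.
Notation j := crossing_branch.

Let branch_facts : [/\ F j wH = 0, F (~~ j) wH != 0, sqrt_re A B wH != 0 &
  exists2 a, 0 < a & is_derive wH 1 (F j) a].
Proof.
have [k [_ kat kout]] := inner_branch_exists hB hs.
have Fk := kat _ wHn; have Fk' : 0 < F (~~ k) wH by apply: kout; rewrite wHn.
have jk : j = k.
  rewrite /crossing_branch; case: k Fk Fk' {kat kout} => /= h1 h2; last by rewrite h1 eqxx.
  by rewrite gt_eqF.
have xH : sqrt_re A B wH != 0 by apply: (sqrt_re_neq0 hB hs); rewrite wHn.
rewrite jk; split=> //; first by rewrite gt_eqF.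
have [_ [a fa a0]] : simple_root f wH by case: hs.
exists (a / F (~~ k) wH); first by rewrite divr_gt0 // (modulus_eq_derive_gt0 hB hs fa).
have Fkn : F (~~ k) wH != 0 by rewrite gt_eqF.
have Fkc : {for wH, continuous (F (~~ k))} by exact: modulus_factor_cvg.
have e : a = a / F (~~ k) wH * F (~~ k) wH by apply/esym; exact: divfK.
exact: (is_derive_mul_root (modulus_eq_mulE A B k) e Fk Fkc Fkn).1 fa.
Qed.

(** The condition e^(- i tau wH) = Y amounts to e^(i tau wH) = conj Y, hence the conjugate in the
    argument defining [phiH]. *)
Let u := (Y j wH)^*%C.

Let u_unit : normc u = 1.
Proof.
have [Fj _ _ _] := branch_facts.
have -> : normc u = normc (Y j wH) by rewrite /u; case: (Y j wH) => x y /=; rewrite sqrrN.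
by apply/eqP; rewrite normc_Ybr_eq1 // Fj.
Qed.

Let phiH_E : phiH A B wH = carg u.
Proof.
rewrite /phiH -/crossing_branch; congr carg.
rewrite /u /Ybr; apply/complex_eqP; split => /=; ring.
Qed.

Let tauk_E k : tauk A B wH k * wH = carg u + 2 * pi * k%:R.
Proof. by rewrite /tauk mulrC mulrA divff ?gt_eqF // mul1r phiH_E. Qed.

Let cexp_tau tau : cos (tau * wH) = Re u -> sin (tau * wH) = Im u ->
  cexp (- (tau%:C * (0 +i* wH))) = Y j wH.
Proof.
move=> hc hsn; rewrite cexp_imag hc hsn /u; case: (Y j wH) => x y /=.
by rewrite opprK.
Qed.

Lemma simple_pair_destabilizing k : destabilizing_crossing A B (tauk A B wH k) wH.
Proof.
have [Fj Fj' xH [a a0 Fja]] := branch_facts.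
apply: (destabilizing_crossing_ex wH0 Fj Fj' xH a0 Fja).
have [hc hsn _] := carg_unit u_unit.
apply: cexp_tau; rewrite tauk_E.
  by rewrite -[k%:R]/(k%:Z%:~R) cos_periodic_int.
by rewrite -[k%:R]/(k%:Z%:~R) sin_periodic_int.
Qed.

Let char_root_branch tau : char_root A B tau (0 +i* wH) ->
  cexp (- (tau%:C * (0 +i* wH))) = Y j wH.
Proof.
have [_ Fj' _ _] := branch_facts.
move=> /char_root_imag [s [e Fs]].
have [<- //|/neq_negb sj] := eqVneq s j.
by rewrite -sj Fs eqxx in Fj'.
Qed.

Lemma char_root_tauk tau : 0 < tau -> char_root A B tau (0 +i* wH) ->
  exists k : nat, tau = tauk A B wH k.
Proof.
move=> tau0 /char_root_branch e.
have [hc hsn hpi] := carg_unit u_unit.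
have [h1 h2] : cos (tau * wH) = Re u /\ sin (tau * wH) = Im u.
  by move: e; rewrite cexp_imag /u; case: (Y j wH) => x y /complex_eqP [/= <- <-]; rewrite opprK.
have [k ke] : exists k : int, tau * wH = carg u + 2 * pi * k%:~R.
  by apply: cos_sin_eq; rewrite ?hc ?hsn.
case: k ke => k ke; first by exists k; apply: (mulIf (lt0r_neq0 wH0)); rewrite tauk_E ke.
(* For negative k, [carg u <= pi] gives tau wH <= pi - 2 pi < 0, against tau > 0. *)
have pi0 := pi_gt0 R; have := mulr_gt0 tau0 wH0; rewrite ke.
have -> : (Negz k)%:~R = - (k%:R + 1) :> R by rewrite NegzE mulrNz natr1.
rewrite mulrN mulrDr mulr1.
have : 0 <= 2 * pi * k%:R :> R by rewrite !mulr_ge0 // ltW.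
by set x := 2 * pi * k%:R; lra.
Qed.

(** A conjugate pair may be read from either member, which reduces crossings at - wH to those at
    [wH]. *)
Let crossing_at tau w v : crossing A B tau w v -> crossing A B tau (- w) v.
Proof.
move=> [al [be [near_ab al0 be0 dal]]]; exists al, (fun t => - be t).
split; [|exact: al0|by rewrite be0|exact: dal].
apply: filterS near_ab => t [ca cb r1 r2].
by split; [exact: ca|exact: cvgN|exact: r2|rewrite opprK; exact: r1].
Qed.

Let crossing_char_root tau w v : crossing A B tau w v -> char_root A B tau (0 +i* w).
Proof.
move=> [al [be [/nbhs_singleton [_ _ + _] al0 be0 _]]].
rewrite al0 be0; exact.
Qed.

Lemma crossing_simple_pair tau w v : crossing A B tau w v ->
  [/\ `|w| = wH, char_root A B tau (0 +i* wH) & 0 < v].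
Proof.
move=> cr; have [s [_ Fs]] := char_root_imag (crossing_char_root cr).
have wE : w = wH \/ w = - wH.
  by case: hs => _ _ _; apply; rewrite (modulus_eq_mulE A B s) Fs mul0r.
have {}cr : crossing A B tau wH v.
  case: wE cr => ->; first exact.
  by move=> /crossing_at; rewrite opprK; exact.
have rt := crossing_char_root cr; split; [|exact: rt|].
  by case: wE => ->; rewrite ?normrN.
have [Fj Fj' xH [a a0 Fja]] := branch_facts.
exact: (crossing_rate_gt0 wH0 Fj Fj' xH a0 Fja (char_root_branch rt) cr).
Qed.

End SimplePair.
End Crossings.

Theorem lemma4p2 (R : realType) (A B : 'M[R]_2) (hB : \det B != 0) :
  (class_I A B /\ ACS_transversal A B <->
     exists wH : R, only_simple_pair (modulus_eq A B) wH) /\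
  (forall wH : R, only_simple_pair (modulus_eq A B) wH ->
     (forall k : nat, destabilizing_crossing A B (tauk A B wH k) wH) /\
     (forall tau w : R, 0 < tau -> transverse_crossing A B tau w ->
        [/\ exists k : nat, tau = tauk A B wH k, `|w| = wH
          & ~ stabilizing_crossing A B tau w])).
Proof.
split; first split.
- by move=> [cI tr]; exact: class_I_simple_pair.
- move=> [wH hs]; split; first exact: simple_pair_class_I hs.
  exact: simple_pair_transversal hs.
move=> wH hs; split=> [k|tau w tau0 [v _ cr]]; first exact: simple_pair_destabilizing.
have [wE rt _] := crossing_simple_pair hB hs cr.
split; [exact: (char_root_tauk hB hs tau0 rt)|exact: wE|].
move=> [v' v'0 /(crossing_simple_pair hB hs) [_ _]].
by rewrite ltNge ltW.
Qed.
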